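(* Let $k$ be a field with $\mathrm{char}\,k\ne2$ and let $G=\langle\rho\rangle\simeq C_2$ act on the rational function field $k(x_1,x_2,x_3,x_4)$ by the $k$-automorphism $\rho: x_1\mapsto -x_1,\ x_2\mapsto \frac{x_4}{x_2},\ x_3\mapsto\frac{(x_4-1)(x_4-x_1^2)}{x_3},\ x_4\mapsto x_4.$ Then $k(x_1,x_2,x_3,x_4)^G$ is not retract $k$-rational.
   Context: A field $F\supset k$ is retract $k$-rational if there is a $k$-algebra $A\subset F$ with quotient field $F$, a nonzero $f\in k[t_1,\ldots,t_m]$, and $k$-algebra homomorphisms $\varphi:A\to k[t_1,\ldots,t_m][1/f]$, $\psi:k[t_1,\ldots,t_m][1/f]\to A$ with $\psi\circ\varphi=\mathrm{id}_A$. *)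

(* Defs.v *)
From HB Require Import structures.
From mathcomp Require Import all_boot all_order all_algebra.
Set Implicit Arguments. Unset Strict Implicit. Unset Printing Implicit Defensive.
Import Order.TTheory GRing.Theory Num.Theory.
Local Open Scope ring_scope.

Notation "x %:F" := (@FracField.tofrac _ x) : ring_scope.

(* polynomial ring R[t_0,...,t_{m-1}] as iterated univariate polynomials;
   the outermost variable is t_{m-1}. *)
Fixpoint mpoly (R : idomainType) (m : nat) : idomainType :=
  match m with 0 => R | S m' => {poly (mpoly R m')} end.

Fixpoint mcst (R : idomainType) (m : nat) : R -> mpoly R m :=
  match m return R -> mpoly R m with
  | 0 => fun c => c
  | S m' => fun c => (@mcst R m' c)%:P
  end.

Fixpoint mvar (R : idomainType) (m : nat) (i : nat) : mpoly R m :=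
  match m return mpoly R m with
  | 0 => 0
  | S m' => if i == m' then 'X else (mvar R m' i)%:P
  end.

Fixpoint meval (R : idomainType) (K : comNzRingType) (f : R -> K) (a : nat -> K)
  (m : nat) : mpoly R m -> K :=
  match m return mpoly R m -> K with
  | 0 => f
  | S m' => fun p => (map_poly (@meval R K f a m') p).[a m']
  end.

(* the rational function field k(x_1,...,x_4); x_{i+1} is mvar i *)
Definition ratfun4 (k : fieldType) := {fraction (mpoly k 4)}.

Definition X4 (k : fieldType) (i : nat) : ratfun4 k := (mvar k 4 i)%:F.

Definition cst4 (k : fieldType) (c : k) : ratfun4 k := (mcst 4 c)%:F.

Definition rho_img (k : fieldType) (i : nat) : ratfun4 k :=
  match i with
  | 0 => - X4 k 0
  | 1 => X4 k 3 / X4 k 1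
  | 2 => (X4 k 3 - 1) * (X4 k 3 - X4 k 0 ^+ 2) / X4 k 2
  | _ => X4 k 3
  end.

Definition rho_pol (k : fieldType) (p : mpoly k 4) : ratfun4 k :=
  @meval k (ratfun4 k) (@cst4 k) (@rho_img k) 4 p.

Definition rho (k : fieldType) (x : ratfun4 k) : ratfun4 k :=
  @rho_pol k (\n_(repr x)) / @rho_pol k (\d_(repr x)).

Definition fixed_field (k : fieldType) : pred (ratfun4 k) :=
  fun x => rho x == x.

Definition in_loc (k : fieldType) (m : nat) (f : mpoly k m)
  (u : {fraction (mpoly k m)}) : Prop :=
  exists (p : mpoly k m) (n : nat), u = p%:F / (f%:F) ^+ n.

(* Retract k-rationality of a field F, given as a subfield F of an ambient
   field K containing k via iota.  A is a k-subalgebra of F with quotient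
   field F; phi : A -> k[t][1/f], psi : k[t][1/f] -> A are k-algebra
   homomorphisms with psi o phi = id_A. *)
Definition retract_rational (k K : fieldType) (iota : k -> K) (F : pred K) : Prop :=
  exists (A : pred K) (m : nat) (f : mpoly k m)
         (phi : K -> {fraction (mpoly k m)}) (psi : {fraction (mpoly k m)} -> K),
    [/\
        [/\ (forall c, iota c \in A),
        (forall a b, a \in A -> b \in A -> [/\ a + b \in A, - a \in A & a * b \in A]),
        {subset A <= F} &
        (forall x, x \in F -> exists a b, [/\ a \in A, b \in A, (b != 0) & (x = a / b)])],
        f != 0,
        [/\ (forall a, a \in A -> in_loc f (phi a)),
            (forall a b, a \in A -> b \in A -> phi (a + b) = phi a + phi b),
            (forall a b, a \in A -> b \in A -> phi (a * b) = phi a * phi b) &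
            (forall c, phi (iota c) = (mcst m c)%:F)],
        [/\ (forall u, in_loc f u -> psi u \in A),
            (forall u v, in_loc f u -> in_loc f v -> psi (u + v) = psi u + psi v),
            (forall u v, in_loc f u -> in_loc f v -> psi (u * v) = psi u * psi v) &
            (forall c, psi ((mcst m c)%:F) = iota c)] &
        (forall a, a \in A -> psi (phi a) = a)].

(* Main.v *)
Require Import Defs.
From HB Require Import structures.
From mathcomp Require Import all_boot all_order all_algebra all_field.
From mathcomp Require Import ring zify.
From Stdlib Require Import Classical.
Import GRing.Theory.
Local Open Scope ring_scope.
Set Implicit Arguments. Unset Strict Implicit. Unset Printing Implicit Defensive.

(* Write y = x_1^2 and u = x_4. The fixed field F contains y, u and splits as the
   function field of u = a^2 - y b^2, (u-1)(u-y) = c^2 - y d^2, and the obstruction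
   is the quaternion class (y, u-1), which is unramified once -1 is a square.

   If F were a retract, a ring A with fraction field F would embed in k[t][1/f] by
   phi, with retraction psi. Two homomorphisms J1, J2 from F to a field E containing
   a square root of -1 give, through psi, two points of affine space over E;
   restricting to the line (coordinate s) joining them and composing with phi
   extends J1 and J2 to a point of F over E(s). There the class is unramified at
   every prime of E[s], so it is constant: a Minkowski-type dimension count shows
   that if the form <1, -y, -(u-1)> is isotropic at s = 1, then it is isotropic over
   E(s), hence at s = 0.

   Take K containing F and a square root of -1, M = K(x_1,x_2,x_3,x_4), and let E be
   the subfield of M fixed by rho. At s = 1 use F -> K -> E, through k(x_1,..,x_4),
   where y becomes a square. At s = 0 use the base change F -> E, where isotropy
   means that u - 1 = z rho(z) for some z in M. Eliminating x_3 and x_2 by comparing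
   divisors, this would give u - 1 = N(c) u^m ((u-1)(u-y))^n with c in K(x_1, u),
   which the multiplicities at u = y (n even) and at u = 1 (n odd) exclude. *)

(** * Fraction fields and polynomial evaluation *)

Lemma frac_repr (R : idomainType) (x : {fraction R}) :
  x = (\n_(repr x))%:F / (\d_(repr x))%:F.
Proof.
have dN0 : (\d_(repr x))%:F != 0 by rewrite tofrac_eq0 denom_ratioP.
apply: (mulIf dN0); rewrite divfK // -[in LHS](reprK x); unlock FracField.tofrac.
rewrite -[LHS]FracField.pi_mul.
apply/eqmodP; rewrite /= FracField.equivfE /FracField.mulf.
rewrite !numden_Ratio ?mulr1 ?oner_eq0 ?denom_ratioP //.
by rewrite reprK mulrC.
Qed.

Lemma fracP (R : idomainType) (x : {fraction R}) :
  exists p q : R, q != 0 /\ x = p%:F / q%:F.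
Proof.
by exists \n_(repr x), \d_(repr x); split; [exact: denom_ratioP | exact: frac_repr].
Qed.

(** Injectivity is an argument of the term, so that the ring morphism structure can be attached to
    [frac_lift finj]. *)
Definition frac_lift (R : idomainType) (K : fieldType) (f : {rmorphism R -> K})
    (_ : injective f) (x : {fraction R}) : K :=
  f \n_(repr x) / f \d_(repr x).

Section FracLift.
Variables (R : idomainType) (K : fieldType) (f : {rmorphism R -> K}).
Hypothesis finj : injective f.
Let g := frac_lift finj.

Let f_neq0 p : p != 0 -> f p != 0.
Proof. by move=> pN0; rewrite -(rmorph0 f) (inj_eq finj). Qed.

Lemma frac_lift_div p q : q != 0 -> g (p%:F / q%:F) = f p / f q.
Proof.
move=> qN0; rewrite /g /frac_lift; set x := p%:F / q%:F.
have dN0 := denom_ratioP (repr x).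
have /eqP : p%:F / q%:F = (\n_(repr x))%:F / (\d_(repr x))%:F by exact: frac_repr.
rewrite eqr_div ?tofrac_eq0 // -!tofracM tofrac_eq => /eqP E.
by apply/eqP; rewrite eqr_div ?f_neq0 // -!rmorphM E.
Qed.

Lemma frac_lift_tofrac p : g p%:F = f p.
Proof. by rewrite -[p%:F]divr1 -tofrac1 frac_lift_div ?oner_eq0 // rmorph1 divr1. Qed.

Fact frac_lift_is_zmod_morphism : zmod_morphism g.
Proof.
move=> x y; have [p [q [qN0 ->]]] := fracP x; have [r [s [sN0 ->]]] := fracP y.
rewrite -mulNr -rmorphN addf_div ?tofrac_eq0 // -!rmorphM -rmorphD.
rewrite !frac_lift_div ?mulf_neq0 // -mulNr -rmorphN addf_div ?f_neq0 //.
by rewrite -!rmorphM -rmorphD.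
Qed.

Fact frac_lift_is_monoid_morphism : monoid_morphism g.
Proof.
split=> [|x y]; first by rewrite -tofrac1 frac_lift_tofrac rmorph1.
have [p [q [qN0 ->]]] := fracP x; have [r [s [sN0 ->]]] := fracP y.
rewrite mulf_div -!rmorphM.
by rewrite !frac_lift_div ?mulf_neq0 // mulf_div -!rmorphM.
Qed.

HB.instance Definition _ := GRing.isZmodMorphism.Build {fraction R} K
  (frac_lift finj) frac_lift_is_zmod_morphism.
HB.instance Definition _ := GRing.isMonoidMorphism.Build {fraction R} K
  (frac_lift finj) frac_lift_is_monoid_morphism.

End FracLift.

Section Meval.
Variables (R : idomainType) (K : comNzRingType) (f : {rmorphism R -> K}).
Variable a : nat -> K.

Fact meval_is_morphism m :
  zmod_morphism (@meval R K f a m) /\ monoid_morphism (@meval R K f a m).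
Proof.
elim: m => [|m [IHz IHm]] /=.
  by split; [exact: rmorphB | split; [exact: rmorph1 | exact: rmorphM]].
pose h : {rmorphism mpoly R m -> K} := HB.pack (@meval R K f a m)
  (GRing.isZmodMorphism.Build _ _ _ IHz) (GRing.isMonoidMorphism.Build _ _ _ IHm).
split=> [p q|]; first by rewrite (rmorphB (map_poly h)) hornerD hornerN.
split=> [|p q]; first by rewrite (rmorph1 (map_poly h)) hornerC.
by rewrite (rmorphM (map_poly h)) hornerM.
Qed.

HB.instance Definition _ m := GRing.isZmodMorphism.Build (mpoly R m) K
  (@meval R K f a m) (proj1 (meval_is_morphism m)).
HB.instance Definition _ m := GRing.isMonoidMorphism.Build (mpoly R m) K
  (@meval R K f a m) (proj2 (meval_is_morphism m)).

Lemma meval_cst m c : meval f a (mcst m c) = f c.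
Proof. by elim: m => //= m IH; rewrite map_polyC hornerC. Qed.

Lemma meval_var m i : (i < m)%N -> meval f a (mvar R m i) = a i.
Proof.
elim: m => //= m IH; rewrite ltnS leq_eqVlt.
case: eqP => [-> _|_ /= lim]; first by rewrite map_polyX hornerX.
by rewrite map_polyC hornerC; apply: IH.
Qed.

End Meval.

(** The universal property of the polynomial ring. It is stated for a bare function [g], since it is
    later applied to composites with [psi], which is additive and multiplicative only on the
    localization. *)
Lemma meval_unique (R : idomainType) (K : comNzRingType) (f : {rmorphism R -> K})
    (a : nat -> K) (m : nat) (g : mpoly R m -> K) :
  {morph g : p q / p + q} -> {morph g : p q / p * q} ->
  (forall c, g (mcst m c) = f c) ->
  (forall i, (i < m)%N -> g (mvar R m i) = a i) ->
  forall p, g p = meval f a p.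
Proof.
elim: m g => [|m IH] g gD gM gC gX p /=; first exact: gC.
have gP q : g q%:P = meval f a q.
  apply: (IH (fun q => g q%:P)) => [q1 q2|q1 q2|c|i lim].
  - by rewrite polyCD gD.
  - by rewrite polyCM gM.
  - exact: (gC c).
  - by rewrite -gX ?(leqW lim) //= ltn_eqF.
elim/poly_ind: p => [|p c IHp].
  by rewrite (rmorph0 (map_poly (@meval R K f a m))) horner0 -[0]polyC0 gP rmorph0.
rewrite gD gM gP IHp (rmorphD (map_poly (@meval R K f a m))) /= rmorphM /=.
rewrite map_polyX map_polyC hornerMXaddC; congr (_ * _ + _).
by rewrite -gX //= eqxx.
Qed.

(** * Local solvability at a prime of E[s] *)

Section Valuation.
Variables (E : fieldType) (pi : {poly E}).
Hypothesis pi_irr : irreducible_poly pi.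
Implicit Types p q r t x y z : {poly E}.

Lemma irredp_dvdM p q : (pi %| p * q) = (pi %| p) || (pi %| q).
Proof.
apply/idP/orP => [|[]]; last 2 first; [exact: dvdp_mulr | exact: dvdp_mull |].
have [?|npip] := boolP (pi %| p); first by left.
by rewrite Gauss_dvdpr ?irreducible_poly_coprime //; right.
Qed.

Let pi_neq0 : pi != 0 := irredp_neq0 pi_irr.

(** The property is boolean, so that [xchoose] turns it into functions; at [p = 0] the implication
    holds for any pair and the chosen one carries no information. *)
Lemma val_decomp_exists p : exists w : nat * {poly E},
  (p != 0) ==> (p == pi ^+ w.1 * w.2) && ~~ (pi %| w.2).
Proof.
have [n] := ubnP (size p); elim: n p => // n IH p szp.
have [->|pN0] := eqVneq p 0; first by exists (0%N, 0).
have [/dvdpP [q pE]|npip] := boolP (pi %| p); last first.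
  by exists (0%N, p); rewrite /= mul1r eqxx.
have qN0 : q != 0 by apply: contra_neq pN0; rewrite pE => ->; rewrite mul0r.
have [|[m p0] /implyP/(_ qN0)/andP[/eqP qE np0]] := IH q.
  have : (size q < size p)%N.
    have := qN0; rewrite -size_poly_gt0 pE size_mul //.
    case: (pi_irr); move: (size q) (size pi) => a b szpi _.
    by clear -szpi; lia.
  by lia.
by exists (m.+1, p0); rewrite /= np0 andbT pE {1}qE exprSr /= mulrAC.
Qed.

Definition valp p : nat := (xchoose (val_decomp_exists p)).1.
Definition unitp p : {poly E} := (xchoose (val_decomp_exists p)).2.

Lemma valpE p : p != 0 -> p = pi ^+ valp p * unitp p.
Proof.
by move=> pN0; have /implyP/(_ pN0)/andP[/eqP] := xchooseP (val_decomp_exists p).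
Qed.

Lemma unitp_ndvd p : p != 0 -> ~~ (pi %| unitp p).
Proof.
by move=> pN0; have /implyP/(_ pN0)/andP[] := xchooseP (val_decomp_exists p).
Qed.

Lemma val_decomp_uniq m n x y : ~~ (pi %| x) -> ~~ (pi %| y) ->
  pi ^+ m * x = pi ^+ n * y -> m = n /\ x = y.
Proof.
elim: m n => [|m IH] [|n] nx ny; rewrite ?expr0 ?mul1r //.
- by move=> xE; case/negP: nx; rewrite xE exprS -mulrA dvdp_mulr.
- by move=> xE; case/negP: ny; rewrite -xE exprS -mulrA dvdp_mulr.
by rewrite !exprS -!mulrA => /(mulfI pi_neq0)/IH[] // -> ->.
Qed.

Lemma valp_unique n x : ~~ (pi %| x) ->
  valp (pi ^+ n * x) = n /\ unitp (pi ^+ n * x) = x.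
Proof.
move=> nx; have pN0 : pi ^+ n * x != 0.
  by rewrite mulf_neq0 ?expf_neq0 //; apply: contraNneq nx => ->.
by apply/val_decomp_uniq; rewrite ?unitp_ndvd // -valpE.
Qed.

Lemma valpM p q : p != 0 -> q != 0 -> valp (p * q) = (valp p + valp q)%N.
Proof.
move=> pN0 qN0; rewrite {1}(valpE pN0) {1}(valpE qN0) mulrACA -exprD.
by case: (@valp_unique (valp p + valp q) (unitp p * unitp q));
  rewrite // irredp_dvdM negb_or !unitp_ndvd.
Qed.

Lemma unitpM p q : p != 0 -> q != 0 -> unitp (p * q) = unitp p * unitp q.
Proof.
move=> pN0 qN0; rewrite {1}(valpE pN0) {1}(valpE qN0) mulrACA -exprD.
by case: (@valp_unique (valp p + valp q) (unitp p * unitp q));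
  rewrite // irredp_dvdM negb_or !unitp_ndvd.
Qed.

Lemma valpN p : p != 0 -> valp (- p) = valp p /\ unitp (- p) = - unitp p.
Proof.
move=> pN0; have := @valp_unique (valp p) (- unitp p).
by rewrite mulrN -valpE // dvdpNr unitp_ndvd //; apply.
Qed.

Lemma dvdp_valp n p : p != 0 -> (pi ^+ n %| p) -> (n <= valp p)%N.
Proof.
move=> pN0 /dvdpP[q pE]; have qN0 : q != 0.
  by apply: contra_neq pN0; rewrite pE => ->; rewrite mul0r.
rewrite pE mulrC (valpE qN0) mulrA -exprD.
by case: (valp_unique (n + valp q) (unitp_ndvd qN0)) => -> _; rewrite leq_addr.
Qed.

Lemma valp_dvdp n p : p != 0 -> (n <= valp p)%N -> (pi ^+ n %| p).
Proof.
by move=> pN0 le; rewrite (valpE pN0) dvdp_mulr // dvdp_exp2l.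
Qed.

Definition sqmod x := exists r, pi %| x - r ^+ 2.

Lemma sqmodM x y : sqmod x -> sqmod y -> sqmod (x * y).
Proof.
move=> [r hr] [t ht]; exists (r * t).
have -> : x * y - (r * t) ^+ 2 = (x - r ^+ 2) * y + r ^+ 2 * (y - t ^+ 2) by ring.
by apply: dvdp_add; [apply: dvdp_mulr | apply: dvdp_mull].
Qed.

Lemma invmod x : ~~ (pi %| x) -> exists t, pi %| 1 - x * t.
Proof.
rewrite -irreducible_poly_coprime // => /Bezout_eq1_coprimepP[[u v] /= uv].
by exists v; rewrite -uv [x * v]mulrC addrK dvdp_mull.
Qed.

Lemma sqmod_of_ratio x y z : ~~ (pi %| z) -> pi %| x ^+ 2 - y * z ^+ 2 -> sqmod y.
Proof.
move=> /invmod[t ht] hx; exists (x * t).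
have -> : y - (x * t) ^+ 2 = y * (1 - z * t) * (1 + z * t)
  - (x ^+ 2 - y * z ^+ 2) * t ^+ 2 by ring.
by apply: dvdp_sub; apply: dvdp_mulr => //; apply: dvdp_mull.
Qed.

Lemma sqmod_div x y : ~~ (pi %| x) -> sqmod (x * y) -> sqmod x -> sqmod y.
Proof.
move=> nx [q hq] [r hr]; have nr : ~~ (pi %| r).
  apply: contra nx => dr; rewrite -(subrK (r ^+ 2) x) dvdp_add //.
  by rewrite expr2 dvdp_mulr.
apply: (@sqmod_of_ratio q _ r nr).
have -> : q ^+ 2 - y * r ^+ 2 = y * (x - r ^+ 2) - (x * y - q ^+ 2) by ring.
by apply: dvdp_sub => //; apply: dvdp_mull.
Qed.

End Valuation.

(** * Residues of quaternion symbols at a prime *)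

Section Symbol.
Variables (E : fieldType) (im : E).
Hypothesis im2 : im ^+ 2 = -1.
Variable pi : {poly E}.
Hypothesis pi_irr : irreducible_poly pi.
Implicit Types a b p q r t x y z u d : {poly E}.

Let v := valp pi_irr.
Let up := unitp pi_irr.

(* [p] is a square in the completion at [pi]. *)
Definition locsq p := [/\ p != 0, ~~ odd (v p) & sqmod pi (up p)].

(* The quaternion algebra (a, b) has trivial residue at [pi]; since -1 is a
   square, the residue is the class of a^(v b) b^(v a). *)
Definition unram a b :=
  [\/ ~~ odd (v a) /\ ~~ odd (v b), locsq a, locsq b | locsq (a * b)].

Lemma odd_valM p q : p != 0 -> q != 0 -> odd (v (p * q)) = odd (v p) (+) odd (v q).
Proof. by move=> pN0 qN0; rewrite /v valpM // oddD. Qed.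

Lemma locsq_even p : locsq p -> ~~ odd (v p).
Proof. by case. Qed.

Lemma locsqM p q : locsq p -> locsq q -> locsq (p * q).
Proof.
move=> [pN0 op sp] [qN0 oq sq]; split; first by rewrite mulf_neq0.
  by rewrite odd_valM // (negPf op).
by rewrite /up unitpM //; apply: sqmodM.
Qed.

Lemma locsq_div p q : q != 0 -> locsq (p * q) -> locsq p -> locsq q.
Proof.
move=> qN0 [_ opq spq] [pN0 op sp]; split=> //.
  by move: opq; rewrite odd_valM // (negPf op).
by move: spq; rewrite /up unitpM // => /(sqmod_div pi_irr); apply; rewrite ?unitp_ndvd.
Qed.

Lemma locsq_sqr p : p != 0 -> locsq (p ^+ 2).
Proof.
move=> pN0; split; first by rewrite expf_neq0.
  by rewrite expr2 odd_valM // addbb.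
by exists (up p); rewrite /up !expr2 unitpM // subrr dvdp0.
Qed.

Lemma locsqN p : locsq p -> locsq (- p).
Proof.
move=> [pN0 op [r hr]]; have [vN uN] := valpN pi_irr pN0.
split; rewrite ?oppr_eq0 // /v ?vN // /up uN; exists (im%:P * r).
rewrite exprMn -rmorphXn im2 /= polyCN mulN1r opprK -dvdpNr opprD opprK.
by rewrite -/(up p) in hr.
Qed.

Lemma locsqMr p q : q != 0 -> locsq (p * q ^+ 2) -> locsq p.
Proof.
move=> qN0 h; have pN0 : p != 0.
  by case: h => h _ _; apply: contraNneq h => ->; rewrite mul0r.
by apply: (@locsq_div (q ^+ 2)) => //; rewrite 1?mulrC //; apply: locsq_sqr.
Qed.

(** [a + b = a (1 + b/a)] with [b/a] of positive valuation, so the unit parts of [a] and [a + b]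
    agree modulo [pi]. *)
Lemma locsq_near a b : a != 0 -> a + b != 0 -> (b != 0 -> (v a < v b)%N) ->
  locsq (a * (a + b)).
Proof.
move=> aN0 sN0 vab; have [b0|bN0] := eqVneq b 0.
  by rewrite b0 addr0 -expr2; apply: locsq_sqr.
have na := unitp_ndvd pi_irr aN0.
have [k kE] : exists k, v b = (v a + k.+1)%N.
  by exists (v b - (v a).+1)%N; have := vab bN0; lia.
set c := pi ^+ k.+1 * up b.
have sE : a + b = pi ^+ v a * (up a + c).
  by rewrite mulrDr mulrA -exprD -kE -!valpE.
have dc : pi %| c by rewrite /c exprS -mulrA dvdp_mulr.
have ns : ~~ (pi %| up a + c) by rewrite (dvdp_addl _ dc).
have [vE uE] := valp_unique pi_irr (v a) ns.
split; rewrite ?mulf_neq0 //; first by rewrite odd_valM // /v sE vE addbb.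
exists (up a); rewrite /up unitpM // sE uE mulrDr -expr2 addrC addKr.
by rewrite dvdp_mull.
Qed.

Lemma unramP a b : a != 0 -> b != 0 -> unram a b -> odd (v a) ->
  locsq b \/ locsq (a * b).
Proof.
by move=> aN0 bN0 [[/negPf-> _]|/locsq_even/negPf->| |] //; [left|right].
Qed.

Lemma unram_even a b : a != 0 -> b != 0 -> ~~ odd (v a) -> unram a b ->
  locsq a \/ ~~ odd (v b).
Proof.
move=> aN0 bN0 ea [[_ eb]| |/locsq_even|/locsq_even]; [by right|by left|by right|].
by rewrite odd_valM // (negPf ea); right.
Qed.

(** The residue of [(a, b)] depends on [b] only up to local squares. *)
Lemma unram_sim a b c : a != 0 -> b != 0 -> c != 0 -> locsq (b * c) ->
  unram a b -> unram a c.
Proof.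
move=> aN0 bN0 cN0 sbc; have := locsq_even sbc; rewrite odd_valM // => obc.
case=> [[ea eb]|sa|sb|sab]; [|by constructor 2| |].
- by constructor 1; move: obc; rewrite (negPf eb).
- by constructor 3; apply: locsq_div sb.
constructor 4; apply: (@locsqMr _ b) => //.
by have := locsqM sab sbc; congr locsq; ring.
Qed.

(** [(a, -a)] splits and -1 is a square, so [(a, a b)] and [(a, b)] are the same class. *)
Lemma unram_mul a b : a != 0 -> b != 0 -> unram a b -> unram a (a * b).
Proof.
move=> aN0 bN0; case=> [[ea eb]|sa|sb|sab].
- by constructor 1; rewrite odd_valM // (negPf ea).
- by constructor 2.
- constructor 4; have := locsqM (locsq_sqr aN0) sb; congr locsq; ring.
- by constructor 3.
Qed.

(** Up to squares [u] is a norm from the extension by a square root of [y], so the symbol splits.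
    Locally, if [a ^+ 2] dominates then [u] is a square; if [y * b ^+ 2] dominates then [u * y] is
    one up to sign. At equal valuations [y] has even valuation, and either so has [u], or the
    leading terms cancel and the unit part of [y] is a square modulo [pi]. *)
Lemma unram_norm y u h a b : y != 0 -> u != 0 -> h != 0 ->
  u * h ^+ 2 = a ^+ 2 - y * b ^+ 2 -> unram y u.
Proof.
move=> yN0 uN0 hN0 E0; set w := u * h ^+ 2 in E0.
have wN0 : w != 0 by rewrite mulf_neq0 ?expf_neq0.
suff : unram y w.
  apply: unram_sim => //.
  by have := locsq_sqr (mulf_neq0 uN0 hN0); congr locsq; rewrite /w; ring.
have [a0|aN0] := eqVneq a 0.
  have bN0 : b != 0 by apply: contraNneq wN0 => b0; rewrite E0 a0 b0; apply/eqP; ring.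
  constructor 4; rewrite E0 a0.
  have := locsqN (locsq_sqr (mulf_neq0 yN0 bN0)); congr locsq; ring.
have sa := locsq_sqr aN0; have a2N0 : a ^+ 2 != 0 by rewrite expf_neq0.
have [b0|bN0] := eqVneq b 0.
  by constructor 3; rewrite E0 b0 expr0n mulr0 subr0.
have b2N0 : b ^+ 2 != 0 by rewrite expf_neq0.
set c := - (y * b ^+ 2) in E0; have ybN0 : y * b ^+ 2 != 0 by rewrite mulf_neq0.
have cN0 : c != 0 by rewrite oppr_eq0.
have vc : v c = (v y + (v b + v b))%N.
  by rewrite /c /v (valpN _ ybN0).1 !expr2 !valpM ?mulf_neq0.
have va2 : v (a ^+ 2) = (v a + v a)%N by rewrite /v expr2 valpM.
have [lt|lt|eqv] := ltngtP (v (a ^+ 2)) (v c).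
- constructor 3; apply: (@locsq_div (a ^+ 2)) => //.
  by rewrite E0; apply: locsq_near; rewrite -?E0.
- constructor 4; apply: (@locsqMr _ b) => //.
  have /locsqN : locsq (c * (c + a ^+ 2)) by apply: locsq_near; rewrite 1?addrC -?E0.
  by rewrite [c + _]addrC -E0 /c; congr locsq; ring.
have ey : ~~ odd (v y) by move: eqv; rewrite vc va2; clear; lia.
have [ow|ew] := boolP (odd (v w)); last by constructor 1.
constructor 2; split=> //.
apply: (sqmod_of_ratio pi_irr (x := up a) (z := up b)); first exact: unitp_ndvd.
have wE : w = pi ^+ v (a ^+ 2) * (up a ^+ 2 - up y * up b ^+ 2).
  rewrite E0 mulrBr [in LHS](valpE pi_irr a2N0) /c; congr (_ * _ - _).
    by rewrite !expr2 unitpM.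
  rewrite [in LHS](valpE pi_irr ybN0) !expr2 !unitpM ?mulf_neq0 //; congr (_ ^+ _ * _).
  by move: eqv; rewrite /c /v (valpN _ ybN0).1 !expr2 => ->.
apply/negPn/negP => nd; have [vw _] := valp_unique pi_irr (v (a ^+ 2)) nd.
by move: ow; rewrite wE /v vw -/v va2 oddD addbb.
Qed.

(* Homogenised by [d]: the coordinates on the base are u/d and y/d. *)
Lemma unram_main y u d :
  y != 0 -> u != 0 -> d != 0 -> u - d != 0 -> u - y != 0 ->
  unram (y * d) (u * d) -> unram (y * d) ((u - d) * (u - y)) ->
  unram (y * d) ((u - d) * d).
Proof.
move=> yN0 uN0 dN0 udN0 uyN0 h1 h2.
have ydN0 : y * d != 0 by rewrite mulf_neq0.
have [ndN0 nyN0] : - d != 0 /\ - y != 0 by rewrite !oppr_eq0.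
have vN p : p != 0 -> v (- p) = v p by move=> /(valpN pi_irr)[].
(* The term of smaller valuation decides the class of a difference. For [v u < v d], [u - d] has the
   class of [u] and [h1] concludes; for [v u > v d], [(u - d) * d] has the class of -1, a local
   square. *)
have [lt|lt|eqv] := ltngtP (v u) (v d).
- apply: unram_sim h1; rewrite ?mulf_neq0 //.
  have := locsqM (locsq_near uN0 udN0 _) (locsq_sqr dN0); rewrite vN // => /(_ (fun=> lt)).
  by congr locsq; ring.
- constructor 3.
  have := @locsq_near (- d) u ndN0; rewrite addrC vN // => /(_ udN0 (fun=> lt))/locsqN.
  by congr locsq; ring.
(* Now [u] and [d] have equal valuation. If [v y < v d], then [u - y] has the class of [- y], and
   multiplying the second slot by [y * d] turns [h2] into the goal. *)
have [lt|lt|eqy] := ltngtP (v y) (v d).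
- have s1 : locsq (y * (u - y)).
    have := @locsq_near (- y) u nyN0; rewrite addrC vN // eqv => /(_ uyN0 (fun=> lt))/locsqN.
    by congr locsq; ring.
  have := unram_mul ydN0 (mulf_neq0 udN0 uyN0) h2.
  apply: unram_sim; rewrite ?mulf_neq0 //.
  have := locsqM s1 (locsq_sqr (mulf_neq0 dN0 udN0)); congr locsq; ring.
- have s1 : locsq (u * (u - y)).
    by apply: locsq_near; rewrite // vN // eqv.
  have h3 : unram (y * d) ((u - d) * u).
    apply: unram_sim h2; rewrite ?mulf_neq0 //.
    have := locsqM s1 (locsq_sqr udN0); congr locsq; ring.
  (* Here [u - y] has the class of [u]. When [v (y * d)] is odd, [h1] makes [u * d] a local square,
     as [y * d * (u * d)] has odd valuation; so [u] may be replaced by [d] in [h3]. *)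
  have [oyd|eyd] := boolP (odd (v (y * d))).
    have [s|/locsq_even] := unramP ydN0 (mulf_neq0 uN0 dN0) h1 oyd.
      apply: unram_sim h3; rewrite ?mulf_neq0 //.
      have := locsqM s (locsq_sqr udN0); congr locsq; ring.
    by rewrite [v _]/v !valpM ?mulf_neq0 // -/v !oddD -/v eqv;
       move: oyd; rewrite /v valpM // -/v oddD; case: (odd (v y)); case: (odd (v d)).
  have [s|] := unram_even ydN0 (mulf_neq0 udN0 uN0) eyd h3; first by constructor 2.
  rewrite odd_valM // eqv -odd_valM // => ?; by constructor 1.
(* All three valuations agree, so [y * d] has even valuation: either it is a local square or
   [(u - d) * (u - y)] has even valuation. *)
have eyd : ~~ odd (v (y * d)) by rewrite odd_valM // eqy addbb.
have [s|] := unram_even ydN0 (mulf_neq0 udN0 uyN0) eyd h2; first by constructor 2.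
rewrite odd_valM // => par.
have le_min p q n : p != 0 -> q != 0 -> p - q != 0 -> v p = n -> v q = n -> (n <= v (p - q))%N.
  move=> pN0 qN0 pqN0 vp vq; apply: dvdp_valp => //.
  by apply: dvdp_sub; apply: (valp_dvdp (pi_irr := pi_irr)) => //; rewrite -/v ?vp ?vq.
have := le_min _ _ _ uN0 dN0 udN0 eqv erefl; rewrite leq_eqVlt => /orP[/eqP vud|lt1].
  by constructor 1; split=> //; rewrite (odd_valM udN0) // -vud addbb.
have := le_min _ _ _ uN0 yN0 uyN0 eqv eqy; rewrite leq_eqVlt => /orP[/eqP vuy|lt2].
  by constructor 1; split=> //; rewrite (odd_valM udN0) // vuy.
(* Both [u - d] and [u - y] now have valuation larger than [v d], so [d], [u] and [y] have the same
   leading unit and [y * d] is a local square. *)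
constructor 2; have s1 : locsq (d * u).
  by have := @locsq_near d (u - d) dN0; rewrite addrC subrK; apply.
have s2 : locsq (y * u).
  by have := @locsq_near y (u - y) yN0; rewrite addrC subrK eqy; apply.
apply: (@locsqMr _ u) => //; have := locsqM s1 s2; congr locsq; ring.
Qed.

End Symbol.

(** * Isotropy of ternary forms over E[s] by counting dimensions *)

Section Codim.
Variable E : fieldType.
Let V := ({poly E} * {poly E} * {poly E})%type.
Implicit Types (P Q : V -> Prop) (w : V).

(** [P] holds on a subspace of codimension at most [l]. It need not be linear itself: it may be a
    divisibility of the value of a quadratic form. *)
Definition codim_le P l :=
  exists2 g : V -> 'rV[E]_l, linear g & forall w, g w = 0 -> P w.

Lemma codim_le_all P : (forall w, P w) -> codim_le P 0.
Proof.
by move=> allP; exists (fun=> 0) => [a u w|w _]; rewrite ?scaler0 ?addr0 //.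
Qed.

Lemma codim_le_and P Q R l m : codim_le P l -> codim_le Q m ->
  (forall w, P w -> Q w -> R w) -> codim_le R (l + m).
Proof.
move=> [g gl gP] [h hl hQ] PQ; exists (fun w => row_mx (g w) (h w)).
  by move=> a u w; rewrite gl hl scale_row_mx add_row_mx.
move=> w; rewrite -[0]row_mx0 => /eq_row_mx[/gP Pw /hQ Qw]; exact: PQ.
Qed.

(** The remainder modulo [p] is linear and has [deg p] coefficients. *)
Lemma codim_le_dvd (h : V -> {poly E}) p : linear h -> p != 0 ->
  codim_le (fun w => p %| h w) (size p).-1.
Proof.
move=> hl pN0; exists (fun w => poly_rV (h w %% p)) => [a u w|w].
  by rewrite hl modpD modpZl linearP.
move=> h0; rewrite /dvdp -[_ %% _](@poly_rV_K _ (size p).-1) ?h0 ?linear0 //.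
by rewrite -ltnS prednK ?size_poly_gt0 // ltn_modp.
Qed.

(** Rank-nullity on the triples of bounded size, a space of dimension [n1 + n2 + n3]. *)
Lemma codim_le_nontrivial P l n1 n2 n3 : codim_le P l -> (l < n1 + n2 + n3)%N ->
  exists w, [/\ w != 0, P w, (size w.1.1 <= n1)%N, (size w.1.2 <= n2)%N
    & (size w.2 <= n3)%N].
Proof.
move=> [g gl gP] ltl.
pose e (u : 'rV[E]_(n1 + n2 + n3)) : V :=
  (rVpoly (lsubmx (lsubmx u)), rVpoly (rsubmx (lsubmx u)), rVpoly (rsubmx u)).
have el : linear e by move=> a u w; rewrite /e !linearP.
have fl : linear (g \o e) by move=> a u w; rewrite /= el gl.
pose f : {linear 'rV[E]_(n1 + n2 + n3) -> 'rV[E]_l} :=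
  HB.pack (g \o e) (GRing.isLinear.Build _ _ _ _ _ fl).
have kN0 : kermx (lin1_mx f) != 0.
  rewrite -mxrank_eq0 mxrank_ker -lt0n subn_gt0.
  by apply: leq_ltn_trans ltl; apply: rank_leq_col.
exists (e (nz_row (kermx (lin1_mx f)))); set u := nz_row _.
have uN0 : u != 0 by rewrite nz_row_eq0.
have fu : g (e u) = 0.
  have := mul_rV_lin1 f u => /= <-.
  by apply/sub_kermxP; apply: nz_row_sub.
split; rewrite ?size_poly //=; last exact: gP.
apply: contraNneq uN0 => -[/(congr1 (@poly_rV _ n1)) + /(congr1 (@poly_rV _ n2)) +
  /(congr1 (@poly_rV _ n3))]; rewrite !rVpolyK !linear0 => u1 u2 u3.
by rewrite -[u]hsubmxK -[lsubmx u]hsubmxK u1 u2 u3 !row_mx0.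
Qed.

End Codim.

(** * Local lattices on which the form is highly divisible *)

Section Lattice.
Variable E : fieldType.
Let V := ({poly E} * {poly E} * {poly E})%type.
Implicit Types (a b c p q r u x y z : {poly E}) (w : V).

Lemma linear_fst_fst : linear (fun w => w.1.1). Proof. by []. Qed.
Lemma linear_fst_snd : linear (fun w => w.1.2). Proof. by []. Qed.
Lemma linear_snd : linear (fun w => w.2). Proof. by []. Qed.

Section Local.
Variable pi : {poly E}.
Hypothesis pi_neq0 : pi != 0.
Variables h1 h2 h3 : V -> {poly E}.
Hypotheses (h1l : linear h1) (h2l : linear h2) (h3l : linear h3).
Let d := (size pi).-1.

Lemma codim_le_dvdX (h : V -> {poly E}) n : linear h ->
  codim_le (fun w => pi ^+ n %| h w) (d * n).
Proof. by move=> hl; rewrite -size_exp; apply: codim_le_dvd; rewrite ?expf_neq0. Qed.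

(** Requiring [pi ^+ (k2 + k3)] to divide [h1 w], and similarly for the others, makes each term
    divisible by the full power; the three exponents add up to exactly [k1.*2 + k2.*2 + k3.*2]. *)
Lemma lattice_even a1 a2 a3 u1 u2 u3 k1 k2 k3 :
  a1 = pi ^+ k1.*2 * u1 -> a2 = pi ^+ k2.*2 * u2 -> a3 = pi ^+ k3.*2 * u3 ->
  codim_le (fun w => pi ^+ (k1.*2 + k2.*2 + k3.*2)
     %| a1 * h1 w ^+ 2 + a2 * h2 w ^+ 2 + a3 * h3 w ^+ 2)
    (d * (k1.*2 + k2.*2 + k3.*2)).
Proof.
move=> -> -> ->.
have := codim_le_and (R := fun w => [/\ pi ^+ (k2 + k3) %| h1 w, pi ^+ (k1 + k3) %| h2 w
  & pi ^+ (k1 + k2) %| h3 w])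
  (codim_le_and (R := fun w => pi ^+ (k2 + k3) %| h1 w /\ pi ^+ (k1 + k3) %| h2 w)
    (codim_le_dvdX (k2 + k3) h1l) (codim_le_dvdX (k1 + k3) h2l) (fun _ => @conj _ _))
  (codim_le_dvdX (k1 + k2) h3l).
case=> [w [? ?] ?|]; first by split.
have -> : (d * (k2 + k3) + d * (k1 + k3) + d * (k1 + k2) = d * (k1.*2 + k2.*2 + k3.*2))%N.
  by rewrite -!muln2; ring.
move=> g gl gP; exists g => // w /gP[/dvdpP[x ->] /dvdpP[y ->] /dvdpP[z ->]].
apply/dvdpP; exists (u1 * x ^+ 2 + u2 * y ^+ 2 + u3 * z ^+ 2).
by rewrite -!muln2 !exprD !exprM; ring.
Qed.

(* [e, e'] is 0, 1 or 1, 0: the first two coefficients have valuations of the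
   same parity and the binary form they span is isotropic modulo [pi]. *)
Lemma lattice_mixed a1 a2 a3 u1 u2 u3 k1 k2 k3 e e' : (e + e' = 1)%N ->
  ~~ (pi %| u1) -> irreducible_poly pi -> sqmod pi (- (u1 * u2)) ->
  a1 = pi ^+ (k1.*2 + e) * u1 -> a2 = pi ^+ (k2.*2 + e) * u2 ->
  a3 = pi ^+ (k3.*2 + e') * u3 ->
  codim_le (fun w => pi ^+ (k1.*2 + e + (k2.*2 + e) + (k3.*2 + e'))
     %| a1 * h1 w ^+ 2 + a2 * h2 w ^+ 2 + a3 * h3 w ^+ 2)
    (d * (k1.*2 + e + (k2.*2 + e) + (k3.*2 + e'))).
Proof.
move=> ee nu1 pi_irr [r hr] -> -> ->.
(* As [r ^+ 2] is congruent to [- (u1 * u2)], the binary form times [u1] factors modulo [pi] as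
   [(u1 x - r y) (u1 x + r y)]; killing the first factor gains one power of [pi]. The quotients are
   exact on the subspace used, and Euclidean division by a fixed polynomial is linear. *)
pose h w := u1 * (h1 w %/ pi ^+ (k2 + k3)) - r * (h2 w %/ pi ^+ (k1 + k3)).
have hl : linear h.
  move=> a u w; rewrite /h h1l h2l !divpD !divpZl !mulrDr -!scalerAr scalerBr.
  by rewrite opprD addrACA.
have := codim_le_and (R := fun w => [/\ pi ^+ (k2 + k3) %| h1 w, pi ^+ (k1 + k3) %| h2 w
  & pi ^+ (k1 + k2 + e) %| h3 w /\ pi ^+ 1 %| h w])
  (codim_le_and (R := fun w => pi ^+ (k2 + k3) %| h1 w /\ pi ^+ (k1 + k3) %| h2 w)
    (codim_le_dvdX (k2 + k3) h1l) (codim_le_dvdX (k1 + k3) h2l) (fun _ => @conj _ _))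
  (codim_le_and (R := fun w => pi ^+ (k1 + k2 + e) %| h3 w /\ pi ^+ 1 %| h w)
    (codim_le_dvdX (k1 + k2 + e) h3l) (codim_le_dvdX 1 hl) (fun _ => @conj _ _)).
case=> [w [? ?] [? ?]|]; first by split.
have -> : (d * (k2 + k3) + d * (k1 + k3) + (d * (k1 + k2 + e) + d * 1)
    = d * (k1.*2 + e + (k2.*2 + e) + (k3.*2 + e')))%N.
  by rewrite -ee -!muln2; ring.
move=> g gl gP; exists g => // w /gP[]; rewrite /h.
move=> /dvdpP[x ->] /dvdpP[y ->] [/dvdpP[z ->]].
rewrite expr1 !mulpK ?expf_neq0 // => dxy.
have : pi %| u1 * (u1 * x ^+ 2 + u2 * y ^+ 2).
  have -> : u1 * (u1 * x ^+ 2 + u2 * y ^+ 2) =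
    (u1 * x - r * y) * (u1 * x + r * y) - (- (u1 * u2) - r ^+ 2) * y ^+ 2 by ring.
  by apply: dvdp_sub; apply: dvdp_mulr.
rewrite irredp_dvdM // (negPf nu1) => /dvdpP[t tE].
apply/dvdpP; exists (t + u3 * z ^+ 2).
have -> : pi ^+ (k1.*2 + e + (k2.*2 + e) + (k3.*2 + e')) =
    (pi ^+ k1 * pi ^+ k2 * pi ^+ k3) ^+ 2 * pi ^+ e * pi ^+ 1.
  by rewrite -!exprD -exprM -!exprD; congr (_ ^+ _); lia.
rewrite [in RHS]mulrDl.
have -> : t * ((pi ^+ k1 * pi ^+ k2 * pi ^+ k3) ^+ 2 * pi ^+ e * pi ^+ 1) =
   (u1 * x ^+ 2 + u2 * y ^+ 2) * ((pi ^+ k1 * pi ^+ k2 * pi ^+ k3) ^+ 2 * pi ^+ e).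
  by rewrite tE expr1; ring.
have [[-> ->]|[-> ->]] : (e = 0 /\ e' = 1)%N \/ (e = 1 /\ e' = 0)%N by lia.
  by rewrite -!muln2 !exprD !exprM; ring.
by rewrite -!muln2 !exprD !exprM; ring.
Qed.

End Local.

(** The form [<1, -a, -b>], whose isotropy means that the quaternion algebra [(a, b)] splits. *)
Definition tform a b w : {poly E} := w.1.1 ^+ 2 - a * w.1.2 ^+ 2 - b * w.2 ^+ 2.

(** Outside the case of even valuations, triviality of the residue makes one of the binary forms
    [<1, -a>], [<1, -b>], [<-a, -b>] isotropic modulo [pi] after scaling, as [lattice_mixed]
    demands; the last one uses that -1 is a square. *)
Lemma unram_lattice (im : E) pi (pi_irr : irreducible_poly pi) a b :
  im ^+ 2 = -1 -> a != 0 -> b != 0 -> unram pi_irr a b ->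
  codim_le (fun w => pi ^+ (valp pi_irr a + valp pi_irr b) %| tform a b w)
    ((size pi).-1 * (valp pi_irr a + valp pi_irr b)).
Proof.
move=> im2 aN0 bN0 un; set v := valp pi_irr.
have piN0 := irredp_neq0 pi_irr.
pose ua := unitp pi_irr a; pose ub := unitp pi_irr b.
have evenE p : p != 0 -> ~~ odd (v p) -> - p = pi ^+ (v p)./2.*2 * - unitp pi_irr p.
  by move=> pN0 ep; rewrite mulrN even_halfK // -valpE.
have oddE p : p != 0 -> odd (v p) -> - p = pi ^+ ((v p)./2.*2 + 1) * - unitp pi_irr p.
  by move=> pN0 op; rewrite mulrN addn1 odd_halfK // prednK ?odd_gt0 // -valpE.
have n1 : ~~ (pi %| 1).
  by rewrite dvdp1; case: (pi_irr) => sz _; rewrite neq_ltn sz orbT.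
have oneE : 1 = pi ^+ (0.*2 + 0) * 1 :> {poly E} by rewrite mul1r.
have one1E : 1 = pi ^+ (0.*2) * 1 :> {poly E} by rewrite mul1r.
have im2P : (im%:P : {poly E}) ^+ 2 = -1 by rewrite -rmorphXn im2 rmorphN1.
have even_case : ~~ odd (v a) -> ~~ odd (v b) ->
  codim_le (fun w => pi ^+ (v a + v b) %| tform a b w) ((size pi).-1 * (v a + v b)).
  move=> ea eb; have := lattice_even piN0 linear_fst_fst linear_fst_snd linear_snd
    one1E (evenE _ aN0 ea) (evenE _ bN0 eb).
  rewrite !even_halfK // double0 add0n; case=> g gl gP; exists g => // w /gP.
  by rewrite mul1r !mulNr.
have one_case c : c != 0 -> locsq pi_irr c -> sqmod pi (- (1 * - unitp pi_irr c)).
  by move=> cN0 [_ _]; rewrite mul1r opprK.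
case: un => [[ea eb]|sa|sb|sab].
- exact: even_case.
- have ea := locsq_even sa; have [ob|] := boolP (odd (v b)); last exact: even_case.
  have ea' : - a = pi ^+ ((v a)./2.*2 + 0) * - ua by rewrite addn0 evenE.
  have := lattice_mixed piN0 linear_fst_fst linear_fst_snd linear_snd
    (erefl : (0 + 1 = 1)%N) n1 pi_irr (one_case _ aN0 sa) oneE ea' (oddE _ bN0 ob).
  rewrite !addn0 addn1 even_halfK // odd_halfK // prednK ?odd_gt0 // double0 add0n.
  by case=> g gl gP; exists g => // w /gP; rewrite mul1r !mulNr.
- have eb := locsq_even sb; have [oa|] := boolP (odd (v a)); last by move=> ?; apply: even_case.
  have eb' : - b = pi ^+ ((v b)./2.*2 + 0) * - ub by rewrite addn0 evenE.
  have := lattice_mixed piN0 linear_fst_fst linear_snd linear_fst_snd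
    (erefl : (0 + 1 = 1)%N) n1 pi_irr (one_case _ bN0 sb) oneE eb' (oddE _ aN0 oa).
  rewrite !addn0 addn1 even_halfK // odd_halfK // prednK ?odd_gt0 // double0 add0n addnC.
  by case=> g gl gP; exists g => // w /gP; rewrite mul1r !mulNr addrAC.
have := locsq_even sab; rewrite odd_valM // => oab.
have [oa|ea] := boolP (odd (v a)); last first.
  by apply: even_case => //; move: oab; rewrite -/v (negPf ea).
have ob : odd (v b) by move: oab; rewrite -/v oa negbK.
have nua : ~~ (pi %| - ua) by rewrite dvdpNr unitp_ndvd.
have sq : sqmod pi (- (- ua * - ub)).
  case: sab => _ _; rewrite unitpM // -/ua -/ub => -[r hr]; exists (im%:P * r).
  by rewrite exprMn im2P mulN1r opprK mulrNN -dvdpNr opprD opprK.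
have := lattice_mixed piN0 linear_fst_snd linear_snd linear_fst_fst
    (erefl : (1 + 0 = 1)%N) nua pi_irr sq (oddE _ aN0 oa) (oddE _ bN0 ob) oneE.
rewrite !addn1 !odd_halfK // !prednK ?odd_gt0 // double0 !addn0.
by case=> g gl gP; exists g => // w /gP; rewrite mul1r !mulNr addrC addrA.
Qed.

End Lattice.

(** * Global zeros from local lattices *)

Section Isotropy.
Variables (E : fieldType) (im : E).
Hypothesis im2 : im ^+ 2 = -1.
Let V := ({poly E} * {poly E} * {poly E})%type.
Implicit Types (a b p q : {poly E}) (w : V).

Lemma irreducible_divisor p : (1 < size p)%N ->
  exists2 pi : {poly E}, irreducible_poly pi & pi %| p.
Proof.
have [n] := ubnP (size p); elim: n p => // n IH p szp p1.
have [[q [q1 qp nqp]]|nq] := classic (exists q, [/\ size q != 1%N, q %| p & ~~ (q %= p)]).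
  have pN0 : p != 0 by rewrite -size_poly_gt0 ltnW.
  have ltq : (size q < size p)%N.
    by rewrite ltn_neqAle dvdp_leq // andbT; apply: contra nqp; rewrite dvdp_size_eqp.
  have [| |pi ipi dpi] := IH q; first exact: leq_trans ltq _.
    rewrite ltn_neqAle eq_sym q1 size_poly_gt0.
    by apply: contraTneq qp => ->; rewrite dvd0p.
  by exists pi => //; apply: dvdp_trans qp.
exists p => //; split=> // q q1 qp; apply/negPn/negP => nqp; apply: nq.
by exists q.
Qed.

(** Chinese remaindering over the primes of [p]. Coprimality with [q] ensures that [p] contains the
    full power of each of its primes in [a * b], so that the local lattices apply. *)
Lemma lattice_part a b : a != 0 -> b != 0 ->
  (forall pi (pi_irr : irreducible_poly pi), unram pi_irr a b) ->
  forall p q, a * b = p * q -> coprimep p q ->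
  codim_le (fun w => p %| tform a b w) (size p).-1.
Proof.
move=> aN0 bN0 un p; have [n] := ubnP (size p); elim: n p => // n IH p szp q abE cpq.
have abN0 : a * b != 0 by rewrite mulf_neq0.
have pN0 : p != 0 by apply: contraNneq abN0 => p0; rewrite abE p0 mul0r.
have qN0 : q != 0 by apply: contraNneq abN0 => q0; rewrite abE q0 mulr0.
have [p1|p1] := leqP (size p) 1.
  have sp1 : size p = 1%N by apply/eqP; rewrite eqn_leq p1 size_poly_gt0.
  rewrite sp1; apply: codim_le_all => w.
  by move/eqP: sp1; rewrite size_poly_eq1 => /eqp_dvdl->; rewrite dvd1p.
have [pi pi_irr dpi] := irreducible_divisor p1.
have piN0 := irredp_neq0 pi_irr.
set k := valp pi_irr p; set p1' := unitp pi_irr p.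
have pE : p = pi ^+ k * p1' by exact: valpE.
have np1 : ~~ (pi %| p1') by exact: unitp_ndvd.
have nq : ~~ (pi %| q).
  by rewrite -irreducible_poly_coprime //; apply: coprimep_dvdr cpq.
have kE : (valp pi_irr a + valp pi_irr b = k)%N.
  rewrite -valpM // abE valpM //; have [+ _] := valp_unique pi_irr 0 nq.
  by rewrite mul1r => ->; rewrite addn0.
have p1N0 : p1' != 0 by apply: contraNneq np1 => ->.
have cop : coprimep (pi ^+ k) p1' by rewrite coprimep_expl // irreducible_poly_coprime.
have spi : (1 < size pi)%N by case: (pi_irr).
have szE : (size p).-1 = ((size pi).-1 * k + (size p1').-1)%N.
  rewrite pE size_mul ?expf_neq0 // -size_exp.
  have := p1N0; rewrite -size_poly_gt0; have := expf_neq0 k piN0; rewrite -size_poly_gt0.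
  by move: spi; move: (size (pi ^+ k)) (size p1'); clear; lia.
have k0 : (0 < k)%N.
  by rewrite lt0n; apply: contraTneq dpi => k0; rewrite pE k0 mul1r.
have lt1 : (size p1' < size p)%N.
  have := p1N0; rewrite -size_poly_gt0; have := pN0; rewrite -size_poly_gt0.
  have : (0 < (size pi).-1 * k)%N by rewrite muln_gt0 k0 -subn1 subn_gt0 spi.
  by move: szE; move: (_ * _)%N (size p) (size p1'); clear; lia.
have IH1 : codim_le (fun w => p1' %| tform a b w) (size p1').-1.
  apply: (IH _ _ (pi ^+ k * q)); first exact: leq_trans lt1 _.
    by rewrite abE pE; ring.
  rewrite coprimepMr coprimep_sym cop /=.
  by apply: coprimep_dvdr cpq; rewrite pE dvdp_mull.
have := unram_lattice im2 aN0 bN0 (un pi pi_irr); rewrite kE => loc.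
rewrite szE; apply: codim_le_and loc IH1 _ => w d1 d2.
by rewrite pE Gauss_dvdp // d1.
Qed.

Lemma size_mul_sqr_leq p q k : (size q <= k)%N ->
  (size (p * q ^+ 2)%R <= size p + k.*2 - 2)%N.
Proof.
have [->|qN0] := eqVneq q 0; first by rewrite expr0n mulr0 size_poly0.
have [->|pN0] := eqVneq p 0; first by rewrite mul0r size_poly0.
rewrite size_mul ?expf_neq0 // expr2 size_mul //.
move: qN0 pN0; rewrite -!size_poly_gt0.
by move: (size p) (size q); clear; lia.
Qed.

Lemma form_small_eq0 a b m w n1 n2 n3 : 
  (size w.1.1 <= n1)%N -> (size w.1.2 <= n2)%N -> (size w.2 <= n3)%N ->
  m %| tform a b w -> (n1.*2 - 1 < size m)%N ->
  (size a + n2.*2 - 2 < size m)%N -> (size b + n3.*2 - 2 < size m)%N ->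
  tform a b w = 0.
Proof.
move=> s1 s2 s3 dm l1 l2 l3; apply/eqP; apply: contraLR dm => fN0.
apply/negP => /(dvdp_leq fN0); apply/negP; rewrite -ltnNge /tform.
apply: leq_ltn_trans (size_polyD _ _) _; rewrite size_polyN gtn_max.
rewrite (leq_ltn_trans (size_mul_sqr_leq _ s3)) // andbT.
apply: leq_ltn_trans (size_polyD _ _) _; rewrite size_polyN gtn_max.
rewrite (leq_ltn_trans (size_mul_sqr_leq _ s2)) // andbT -[_ ^+ 2]mul1r.
apply: leq_ltn_trans (size_mul_sqr_leq _ s1) _; rewrite size_poly1.
by move: l1; move: (size m); clear; lia.
Qed.

(* The condition that a b divides the value of the form costs deg (a b) dimensions,
   and there are more than deg (a b) free coefficients in degrees that force the
   form to vanish, except when deg a and deg b are both even; the missing dimension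
   is then gained from the point [c]. *)
Lemma unram_isotropic a b c r :
  (forall pi (pi_irr : irreducible_poly pi), unram pi_irr a b) ->
  a.[c] = r ^+ 2 -> r != 0 -> b.[c] != 0 ->
  exists2 w, w != 0 & tform a b w = 0.
Proof.
move=> un ac rN0 bc.
have ac0 : a.[c] != 0 by rewrite ac expf_neq0.
have aN0 : a != 0 by apply: contraNneq ac0 => ->; rewrite horner0.
have bN0 : b != 0 by apply: contraNneq bc => ->; rewrite horner0.
have abN0 : a * b != 0 by rewrite mulf_neq0.
have lat : codim_le (fun w => a * b %| tform a b w) (size (a * b)).-1.
  by apply: (lattice_part aN0 bN0 un (q := 1)); rewrite ?mulr1 ?coprimep1.
have sa := aN0; have sb := bN0; move: sa sb; rewrite -!size_poly_gt0 => sa sb.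
have sab : size (a * b) = (size a + size b).-1 by rewrite size_mul.
have [/andP[oa ob]|noab] := boolP (odd (size a) && odd (size b)); last first.
  have [|w [wN0 dw s1 s2 s3]] := codim_le_nontrivial (n1 := (size (a * b))./2)
      (n2 := (size b)./2) (n3 := (size a)./2) lat.
    rewrite sab; move: noab sa sb; by move: (size a) (size b); clear; lia.
  exists w => //; apply: (form_small_eq0 s1 s2 s3 dw);
    rewrite sab; move: noab sa sb; by move: (size a) (size b); clear; lia.
have Xc : ('X - c%:P : {poly E}) != 0 by rewrite polyXsubC_eq0.
(* The conditions [w.1.1 = r w.1.2] and [w.2 = 0] at [c] make the form vanish there, which adds the
   factor ['X - c%:P] to the modulus. The larger modulus admits one more coefficient in each
   coordinate: three for the price of two. *)
have l1 : linear (fun w => w.1.1 - r *: w.1.2).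
  by move=> u x y; rewrite /= scalerDr !scalerA [r * u]mulrC scalerBr scalerA opprD addrACA.
have cod1 := codim_le_dvd l1 Xc; have cod2 := codim_le_dvd (@linear_snd E) Xc.
rewrite size_XsubC in cod1 cod2.
have lat' : codim_le (fun w => ('X - c%:P) * (a * b) %| tform a b w)
    ((size (a * b)).-1 + (1 + 1)).
  apply: codim_le_and lat (codim_le_and cod1 cod2 (fun _ => @conj _ _)) _.
  move=> w dab [d1 d2]; rewrite Gauss_dvdp; last first.
    by rewrite coprimep_sym coprimep_XsubC rootM negb_or /root ac0.
  move: d1 d2; cbv beta; rewrite 2!dvdp_XsubCl /root !hornerE subr_eq0 => /eqP d1 /eqP d2.
  rewrite dab andbT dvdp_XsubCl /root /tform !hornerE ac d1 d2.
  by apply/eqP; rewrite /=; ring.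
have sab' : size (('X - c%:P) * (a * b)) = (size a + size b)%N.
  by rewrite size_mul // size_XsubC sab; move: sa sb; move: (size a) (size b); clear; lia.
have [|w [wN0 dw s1 s2 s3]] := codim_le_nontrivial (n1 := (size a + size b)./2)
    (n2 := (size b).+1./2) (n3 := (size a).+1./2) lat'.
  rewrite sab; move: oa ob sa sb; by move: (size a) (size b); clear; lia.
exists w => //; apply: (form_small_eq0 s1 s2 s3 dw);
  rewrite sab'; move: oa ob sa sb; by move: (size a) (size b); clear; lia.
Qed.

(** Common factors ['X - c%:P] are divided out of the three coordinates until one of them survives
    evaluation at [c]. *)
Lemma isotropic_specialize a b c w : w != 0 -> tform a b w = 0 ->
  exists x y z : E, [|| x != 0, y != 0 | z != 0] /\
    x ^+ 2 = a.[c] * y ^+ 2 + b.[c] * z ^+ 2.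
Proof.
have [n] := ubnP (size w.1.1 + size w.1.2 + size w.2).
elim: n w => // n IH [[x y] z] /= szw wN0 f0.
have [nr|] := boolP [|| x.[c] != 0, y.[c] != 0 | z.[c] != 0].
  exists x.[c], y.[c], z.[c]; split=> //.
  move/(congr1 (horner_eval c)): f0; rewrite /tform /horner_eval /= !hornerE.
  by move/eqP; rewrite -addrA -opprD subr_eq0 => /eqP.
rewrite !negb_or !negbK => /and3P[/factor_theorem[x' xE]].
move=> /factor_theorem[y' yE] /factor_theorem[z' zE].
have Xc : ('X - c%:P : {poly E}) != 0 by rewrite polyXsubC_eq0.
have szE p : size (p * ('X - c%:P)) = if p == 0 then 0%N else (size p).+1.
  case: eqVneq => [->|pN0]; first by rewrite mul0r size_poly0.
  by rewrite size_mul // size_XsubC addn2.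
apply: (IH (x', y', z')) => /=.
- move: szw; rewrite xE yE zE !szE.
  move: wN0; rewrite xE yE zE.
  case: (eqVneq x' 0) => [->|_]; case: (eqVneq y' 0) => [->|_];
    case: (eqVneq z' 0) => [->|_]; rewrite ?mul0r ?eqxx ?size_poly0 // => _;
    move: (size x') (size y') (size z'); clear; lia.
- by apply: contraNneq wN0 => -[x0 y0 z0]; rewrite xE yE zE x0 y0 z0 !mul0r.
have : ('X - c%:P) ^+ 2 * tform a b (x', y', z') = 0.
  by rewrite -f0 /tform /= xE yE zE; ring.
by move/eqP; rewrite mulf_eq0 expf_eq0 (negPf Xc) => /eqP.
Qed.

End Isotropy.

(** * Function fields with involution *)

Definition eval_morph (R K : comNzRingType) (f : {rmorphism R -> K}) (x : K) :
    {rmorphism {poly R} -> K} :=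
  horner_morph (fun c => mulrC x (f c)).

Lemma eval_morphE (R K : comNzRingType) (f : {rmorphism R -> K}) x p :
  eval_morph f x p = (map_poly f p).[x].
Proof. by []. Qed.

Definition frac_const (K : idomainType) : {rmorphism K -> {fraction {poly K}}} :=
  [the {rmorphism _ -> _} of @FracField.tofrac {poly K} \o @polyC K].

Definition transcendental (K L : fieldType) (iota : {rmorphism K -> L}) (x : L) :=
  forall p : {poly K}, p != 0 -> (map_poly iota p).[x] != 0.

Lemma frac_const_evalE (K : fieldType) (p : {poly K}) :
  (map_poly (frac_const K) p).['X%:F] = p%:F.
Proof.
elim/poly_ind: p => [|p c IH]; first by rewrite rmorph0 horner0 rmorph0.
by rewrite rmorphD rmorphM /= map_polyX map_polyC hornerMXaddC IH rmorphD rmorphM.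
Qed.

Lemma frac_const_transcendental (K : fieldType) : transcendental (frac_const K) 'X%:F.
Proof. by move=> p pN0; rewrite frac_const_evalE tofrac_eq0. Qed.

Section FracMap.
Variables (R : idomainType) (f : {rmorphism R -> R}).
Hypothesis f_inj : injective f.

Let g := [the {rmorphism R -> {fraction R}} of @FracField.tofrac R \o f].

Fact frac_map_inj : injective g.
Proof. by move=> x y /eqP; rewrite /= tofrac_eq => /eqP/f_inj. Qed.

Definition frac_map : {rmorphism {fraction R} -> {fraction R}} := frac_lift frac_map_inj.

Lemma frac_map_tofrac p : frac_map p%:F = (f p)%:F.
Proof. exact: frac_lift_tofrac. Qed.

Lemma frac_map_div p q : q != 0 -> frac_map (p%:F / q%:F) = (f p)%:F / (f q)%:F.
Proof. exact: frac_lift_div. Qed.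

Lemma frac_map_invol : involutive f -> involutive frac_map.
Proof.
move=> ff x; have [p [q [qN0 ->]]] := fracP x.
have fqN0 : f q != 0 by apply: contraNneq qN0 => fq; rewrite -[q]ff fq rmorph0.
by rewrite frac_map_div // frac_map_div // !ff.
Qed.

End FracMap.

Lemma exists_neg_extension (K : fieldType) :
  exists (L : fieldType) (sigma : {rmorphism L -> L}) (iota : {rmorphism K -> L}) (x : L),
  [/\ involutive sigma, sigma x = - x, forall c, sigma (iota c) = iota c
    & transcendental iota x].
Proof.
have invol : involutive (@comp_poly K (- 'X)).
  by move=> p; rewrite -comp_polyA rmorphN /= comp_polyX opprK comp_polyXr.
pose s := frac_map (inv_inj invol).
exists {fraction {poly K}}, s, (frac_const K), 'X%:F; split.
- exact: frac_map_invol.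
- by rewrite frac_map_tofrac /= comp_polyX rmorphN.
- by move=> c; rewrite frac_map_tofrac /= comp_polyC.
- exact: frac_const_transcendental.
Qed.

Lemma norm_clear (F : fieldType) (a b p p' q q' x : F) : q != 0 -> q' != 0 ->
  a = p / q * (p' / q') * x * b -> a * (q * q') = p * p' * x * b.
Proof. by move=> q0 q'0 ->; field; rewrite q0 q'0. Qed.

(** Realised by [K(u)], with [sigma] acting on coefficients. The last clause compares orders of
    vanishing at the fixed points [t] and [1], where a norm [c * tau c] has even order. *)
Lemma exists_trivial_extension (K : fieldType) (sigma : {rmorphism K -> K}) :
  involutive sigma ->
  exists (L : fieldType) (tau : {rmorphism L -> L}) (iota : {rmorphism K -> L}) (u : L),
  [/\ involutive tau, tau u = u, forall c, tau (iota c) = iota (sigma c),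
    transcendental iota u &
    forall (t : K) (c : L) (m n : bool), sigma t = t -> t != 0 -> t != 1 ->
      u - 1 != c * tau c * u ^+ m * ((u - 1) * (u - iota t)) ^+ n].
Proof.
move=> invol.
have mapinvol : involutive (map_poly sigma).
  by move=> p; apply/polyP=> i; rewrite !coef_map /= invol.
pose s := frac_map (inv_inj mapinvol).
exists {fraction {poly K}}, s, (frac_const K), 'X%:F; split.
- exact: frac_map_invol.
- by rewrite frac_map_tofrac /= map_polyX.
- by move=> c; rewrite frac_map_tofrac /= map_polyC.
- exact: frac_const_transcendental.
move=> t c m n st t0 t1; apply/eqP.
have [p [q [qN0 ->]]] := fracP c; rewrite (frac_map_div _ _ qN0) /=.
move=> E.
have qsN0 : map_poly sigma q != 0 by rewrite map_poly_eq0.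
have {}E : ('X - 1) * (q * map_poly sigma q) =
    p * map_poly sigma p * 'X ^+ m * (('X - 1) * ('X - t%:P)) ^+ n.
  apply/eqP; rewrite -tofrac_eq !(tofracM, tofracXn, tofracB, tofrac1); apply/eqP.
  by apply: norm_clear E; rewrite tofrac_eq0.
have pN0 : p != 0.
  apply/eqP => p0; move/eqP: E; rewrite p0 !mul0r !mulf_eq0 (negPf qN0) (negPf qsN0).
  by rewrite -[1]/(1%:P) polyXsubC_eq0.
have psN0 : map_poly sigma p != 0 by rewrite map_poly_eq0.
have mupmap (r : {poly K}) a : sigma a = a -> r != 0 -> mup a (map_poly sigma r) = mup a r.
  move=> sa rN0; apply/eqP.
  have le k : (k <= mup a (map_poly sigma r))%N = (k <= mup a r)%N.
    rewrite !mup_geq ?map_poly_eq0 // -[RHS](dvdp_map sigma) rmorphXn rmorphB /=.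
    by rewrite map_polyX map_polyC /= sa.
  by rewrite eqn_leq -le leqnn le leqnn.
have XN0 : ('X : {poly K}) != 0 by rewrite polyX_eq0.
have X1 : ('X - 1%:P : {poly K}) != 0 by rewrite polyXsubC_eq0.
have Xt : ('X - t%:P : {poly K}) != 0 by rewrite polyXsubC_eq0.
have mupX (a : K) : a != 0 -> mup a 'X = 0%N.
  by move=> aN0; apply: mupNroot; rewrite /root hornerX.
have mupXB (a b : K) : mup a ('X - b%:P) = (b == a) :> nat.
  by have := mup_XsubCX 1 a b; rewrite expr1 => ->; case: (b == a).
have mupb (a : K) (r : {poly K}) (b : bool) : r != 0 -> mup a (r ^+ b) = (b * mup a r)%N.
  by case: b => _; rewrite ?mul1n // mul0n mupNroot // root1.
have mupE a : sigma a = a -> a != 0 ->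
    ((1%R == a) + 2 * mup a q = 2 * mup a p + n * ((1%R == a) + (t == a)))%N.
  move=> sa aN0; have := congr1 (mup a) E.
  rewrite -[('X - 1 : {poly K})]/('X - 1%:P) !(mupM, mupb, mupXB, mupmap, mupX)
    ?(mulf_neq0, expf_neq0) //.
  by rewrite muln0 addn0 !mul2n !addnn.
(* At [t] the identity forces [n] to be even, at [1] to be odd. *)
have /= := mupE _ st t0; rewrite eqxx eq_sym (negPf t1).
have /= := mupE 1 (rmorph1 _) (oner_neq0 _); rewrite eqxx (negPf t1).
by case: (n); clear; lia.
Qed.

Lemma mul_div_expr (F : fieldType) (a b x : F) m n : x != 0 ->
  a * (b / x) ^+ n * x ^+ (m + n) = a * b ^+ n * x ^+ m.
Proof.
move=> x0; rewrite expr_div_n exprD; have := expf_neq0 n x0.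
by move: (x ^+ n) (x ^+ m) (b ^+ n) => y z t y0; field.
Qed.

Lemma div_divK (F : fieldType) (a x : F) : a != 0 -> a / (a / x) = x.
Proof. by move=> a0; rewrite invf_div mulrCA mulfV ?mulr1. Qed.

Lemma norm_shuffle (F : fieldType) (g h ug uh wm bn X Y : F) :
  ug * g * wm = bn * (uh * h) ->
  Y * (wm * (g * (ug * X))) = X * (bn * (h * (uh * Y))).
Proof.
move=> E; transitivity (ug * g * wm * (X * Y)); first by ring.
by rewrite E; ring.
Qed.

Lemma norm_clear2 (F : fieldType) (b d ed eg eh g h w x : F) m n :
  x != 0 -> w != 0 -> d != 0 -> h != 0 -> ed != 0 -> eh != 0 ->
  g * d * x ^+ m / (h * d * x ^+ n) *
    (eg * ed * (w / x) ^+ m / (eh * ed * (w / x) ^+ n)) = b ->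
  eg * g * w ^+ m = b * w ^+ n * (eh * h).
Proof.
move=> x0 w0 d0 h0 ed0 eh0 <-; rewrite !expr_div_n.
have := expf_neq0 n w0; have := expf_neq0 n x0; have := expf_neq0 m x0.
move: (w ^+ n) (x ^+ n) (x ^+ m) (w ^+ m) => wn xn xm wm xm0 xn0 wn0; field.
by rewrite xm0 xn0 wn0 d0 h0 ed0 eh0.
Qed.

(** * The function field of the conic [x * tau x = w] *)

Section Conic.
Variables (K : fieldType) (sigma : {rmorphism K -> K}) (w : K).
Hypotheses (invol : involutive sigma) (wN0 : w != 0) (sw : sigma w = w).
Implicit Types p q g h : {poly K}.

Let sigmaF := [the {rmorphism K -> {fraction {poly K}}} of frac_const K \o sigma].
Let wX : {fraction {poly K}} := w%:P%:F / 'X%:F.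
Let ev := eval_morph sigmaF wX.

Let XN0 : ('X%:F : {fraction {poly K}}) != 0.
Proof. by rewrite tofrac_eq0 polyX_eq0. Qed.

(* X^(deg p) times the image of [p] under X |-> w/X. *)
Definition twisted_rev p : {poly K} :=
  \poly_(j < size p) (sigma p`_((size p).-1 - j) * w ^+ ((size p).-1 - j)).

Lemma ev_twisted_rev p : ev p * 'X%:F ^+ (size p).-1 = (twisted_rev p)%:F.
Proof.
rewrite /ev eval_morphE horner_coef size_map_poly /twisted_rev poly_def.
rewrite rmorph_sum /= mulr_suml [RHS](reindex_inj rev_ord_inj) /=.
apply: eq_bigr => i _; rewrite coef_map /=.
have -> : ((size p).-1 - (size p - i.+1) = i)%N.
  by case: i => i lti /=; move: lti; move: (size p); clear; lia.
have -> : ((sigma p`_i * w ^+ i) *: 'X^(size p - i.+1))%:F =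
    frac_const K (sigma p`_i) * w%:P%:F ^+ i * 'X%:F ^+ (size p - i.+1).
  by rewrite -mul_polyC polyCM polyC_exp tofracM tofracM tofracXn tofracXn.
have -> : (size p).-1 = (size p - i.+1 + i)%N.
  by case: i => i lti /=; move: lti; move: (size p); clear; lia.
exact: mul_div_expr.
Qed.

Lemma twisted_rev0 p : (twisted_rev p).[0] = sigma (lead_coef p) * w ^+ (size p).-1.
Proof.
have [->|pN0] := eqVneq p 0.
  by rewrite /twisted_rev size_poly0 poly_def big_ord0 horner0 lead_coef0 rmorph0 mul0r.
by rewrite horner_coef0 coef_poly subn0 size_poly_gt0 pN0.
Qed.

Lemma twisted_rev_neq0 p : p != 0 -> (twisted_rev p).[0] != 0.
Proof.
by move=> pN0; rewrite twisted_rev0 mulf_neq0 ?expf_neq0 // fmorph_eq0 lead_coef_eq0.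
Qed.

Lemma size_twisted_rev p : p.[0] != 0 -> size (twisted_rev p) = size p.
Proof.
move=> p0; apply: size_poly_eq.
by rewrite subnn mulr1 fmorph_eq0 -horner_coef0.
Qed.

Lemma lead_twisted_rev p : p.[0] != 0 -> lead_coef (twisted_rev p) = sigma p.[0].
Proof.
move=> p0; have sz : (0 < size p)%N.
  by rewrite size_poly_gt0; apply: contraNneq p0 => ->; rewrite horner0.
by rewrite lead_coefE size_twisted_rev // coef_poly prednK // leqnn subnn mulr1 -horner_coef0.
Qed.

Lemma ev_inj : injective ev.
Proof.
apply: raddf_inj => p /eqP ev0; apply/eqP; apply: contraTT ev0 => pN0.
apply: contraTneq (twisted_rev_neq0 pN0) => ev0; have := ev_twisted_rev p.
by rewrite ev0 mul0r => /esym/eqP; rewrite tofrac_eq0 => /eqP->; rewrite horner0 negbK.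
Qed.

Let tau : {rmorphism {fraction {poly K}} -> {fraction {poly K}}} := frac_lift ev_inj.

Lemma tau_tofrac p : tau p%:F = ev p. Proof. exact: frac_lift_tofrac. Qed.

Lemma tau_X : tau 'X%:F = wX.
Proof. by rewrite tau_tofrac /ev eval_morphE map_polyX hornerX. Qed.

Lemma tau_const c : tau (frac_const K c) = frac_const K (sigma c).
Proof. by rewrite tau_tofrac /ev eval_morphE map_polyC hornerC. Qed.

Lemma tau_invol : involutive tau.
Proof.
have tauX : tau wX = 'X%:F.
  rewrite /wX fmorph_div tau_X -[w%:P%:F]/(frac_const K w) tau_const sw.
  by apply: div_divK; rewrite fmorph_eq0.
have tauP p : tau (tau p%:F) = p%:F.
  elim/poly_ind: p => [|p c IH]; first by rewrite tofrac0 !raddf0.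
  have -> : (p * 'X + c%:P)%:F = p%:F * 'X%:F + frac_const K c by rewrite tofracD tofracM.
  rewrite (rmorphD tau) (rmorphM tau) tau_X tau_const.
  by rewrite (rmorphD tau) (rmorphM tau) IH tauX tau_const invol.
move=> x; have [p [q [_ ->]]] := fracP x.
have -> : tau (p%:F / q%:F) = tau p%:F / tau q%:F by exact: fmorph_div.
by rewrite (fmorph_div tau) !tauP.
Qed.

(* Here z = g/h up to a power of X: comparing divisors in z * tau z = b gives
   [twisted_rev h = e g] for a constant [e], and then b = w^n / (e * sigma e). *)
Lemma coprime_norm g h b m n : coprimep g h -> g.[0] != 0 -> h.[0] != 0 -> b != 0 ->
  ev g * g%:F * frac_const K (w ^+ m) = frac_const K (b * w ^+ n) * (ev h * h%:F) ->
  exists e k, e != 0 /\ w ^+ k = b * (e * sigma e) * w ^+ n.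
Proof.
move=> cop g0 h0 bN0 E.
have gN0 : g != 0 by apply: contraNneq g0 => ->; rewrite horner0.
have hN0 : h != 0 by apply: contraNneq h0 => ->; rewrite horner0.
set A := w ^+ m *: (g * twisted_rev g); set B := (b * w ^+ n) *: (h * twisted_rev h).
have {}E : 'X ^+ (size h).-1 * A = 'X ^+ (size g).-1 * B :> {poly K}.
  apply/eqP; rewrite -tofrac_eq /A /B -!mul_polyC.
  have tX k : ('X ^+ k : {poly K})%:F = 'X%:F ^+ k by rewrite tofracXn.
  do ![rewrite tofracM]; rewrite !tX -!ev_twisted_rev; apply/eqP.
  exact: (norm_shuffle _ _ E).
have irrX : irreducible_poly ('X : {poly K}).
  by have := irredp_XsubC (0 : K); rewrite subr0.
have ndX p : p.[0] != 0 -> ~~ ('X %| p).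
  by have := dvdp_XsubCl p 0; rewrite subr0 => ->.
(* Neither [A] nor [B] is divisible by ['X], so the powers of ['X] agree: [g] and [h] have the same
   degree and [A = B]. *)
have [] := val_decomp_uniq irrX _ _ E.
- by apply: ndX; rewrite hornerZ hornerM !mulf_neq0 ?expf_neq0 // twisted_rev_neq0.
- by apply: ndX; rewrite hornerZ hornerM !mulf_neq0 ?expf_neq0 // twisted_rev_neq0.
move=> szE AB.
have dgh : g %| twisted_rev h.
  have : g %| B by rewrite -AB /A dvdpZr ?expf_neq0 // dvdp_mulr.
  by rewrite /B dvdpZr ?mulf_neq0 ?expf_neq0 // Gauss_dvdpr.
have /eqpfP : twisted_rev h %= g.
  rewrite eqp_sym -dvdp_size_eqp // size_twisted_rev //.
  move: szE; move: gN0 hN0; rewrite -!size_poly_gt0.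
  by move: (size h) (size g); clear; case=> [|u] [|v] //= _ _ ->.
rewrite lead_twisted_rev //; set e := _ / _ => revE.
have lg : lead_coef g != 0 by rewrite lead_coef_eq0.
have e0 : e != 0 by rewrite mulf_neq0 ?invr_eq0 // fmorph_eq0.
have h0E : h.[0] = sigma e * sigma (lead_coef g).
  by rewrite -rmorphM /e divfK // invol.
have : w ^+ m *: twisted_rev g = (b * w ^+ n * e) *: h.
  by apply: (mulfI gN0); rewrite -scalerAr -/A AB /B revE; rewrite -!scalerAr scalerA [h * g]mulrC.
move/(congr1 (fun p => p.[0])); rewrite !hornerZ twisted_rev0 h0E => E0.
exists e, ((size g).-1 + m)%N; split=> //.
have slg : sigma (lead_coef g) != 0 by rewrite fmorph_eq0.
apply: (mulfI slg).
transitivity (w ^+ m * (sigma (lead_coef g) * w ^+ (size g).-1)).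
  by rewrite exprD; ring.
by rewrite E0; ring.
Qed.

(** Powers of ['X] and the common divisor are stripped from the numerator and denominator of [z], so
    that [coprime_norm] applies. Since [sigma w = w], even powers of [w] are norms and only the
    parity of an exponent remains. *)
Lemma conic_norm z b : b != 0 -> z * tau z = frac_const K b ->
  exists (c : K) (n : bool), b = c * sigma c * w ^+ n.
Proof.
move=> bN0.
have [p [q [qN0 ->]]] := fracP z; rewrite (fmorph_div tau) !tau_tofrac => E.
have pN0 : p != 0.
  apply: contraNneq bN0 => p0; move: E; rewrite p0 tofrac0 !mul0r => /esym/eqP.
  by rewrite fmorph_eq0.
have [m [g0]] := multiplicity_XsubC p 0; rewrite pN0 subr0 /= => ng0 pE.
have [n [h0]] := multiplicity_XsubC q 0; rewrite qN0 subr0 /= => nh0 qE.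
have g0N0 : g0 != 0 by apply: contraNneq pN0 => p0; rewrite pE p0 mul0r.
have [g [h [d [gE hE dN0 cop]]]] : exists g h d,
    [/\ g0 = g * d, h0 = h * d, d != 0 & coprimep g h].
  exists (g0 %/ gcdp g0 h0), (h0 %/ gcdp g0 h0), (gcdp g0 h0).
  by rewrite !divpK ?dvdp_gcdl ?dvdp_gcdr // gcdp_eq0 (negPf g0N0) coprimep_div_gcd ?g0N0.
have g0' : g.[0] != 0 by move: ng0; rewrite gE rootM negb_or => /andP[].
have h0' : h.[0] != 0 by move: nh0; rewrite hE rootM negb_or => /andP[].
have [e [k [e0 wE]]] : exists e k, e != 0 /\ w ^+ k = b * (e * sigma e) * w ^+ n.
  apply: (coprime_norm (m := m) cop g0' h0' bN0); move: E.
  rewrite pE qE gE hE.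
  have evX : ev 'X = wX by rewrite -tau_tofrac tau_X.
  have hN0 : h != 0 by apply: contraNneq h0' => ->; rewrite horner0.
  rewrite !(rmorphM ev) !(rmorphXn ev) !evX !tofracM !tofracXn.
  rewrite [frac_const K (b * _)]rmorphM !(rmorphXn (frac_const K)).
  apply: norm_clear2.
  - exact: XN0.
  - by rewrite tofrac_eq0 polyC_eq0.
  - by rewrite tofrac_eq0.
  - by rewrite tofrac_eq0.
  - by rewrite -(rmorph0 ev) (inj_eq ev_inj).
  - by rewrite -(rmorph0 ev) (inj_eq ev_inj).
have seN0 : sigma e != 0 by rewrite fmorph_eq0.
(* [b] is [w ^+ k / w ^+ n] divided by the norm of [e]; the halves of the exponents go into [c]. For
   [n] odd and [k] even a factor [w^-1] is left, which is [w] times the norm of [w^-1]. *)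
exists (w ^+ k./2 / (e * w ^+ n./2) * (if odd n && ~~ odd k then w^-1 else 1)), (odd k (+) odd n).
rewrite !rmorphM fmorphV rmorphM !rmorphXn /= sw.
have wn j : w ^+ j = w ^+ odd j * (w ^+ j./2) ^+ 2.
  by rewrite -exprM muln2 -exprD odd_double_half.
move: wE; rewrite (wn k) (wn n); have := expf_neq0 n./2 wN0.
move: (w ^+ k./2) (w ^+ n./2) => y t tN0.
case: (odd k); case: (odd n) => /=; rewrite ?expr1 ?expr0 ?rmorph1 ?fmorphV ?sw => E0.
- by apply: (mulfI wN0); apply: (mulIf (expf_neq0 2 tN0)); apply: (mulIf (mulf_neq0 e0 seN0));
    transitivity (b * (e * sigma e) * (w * t ^+ 2)); [ring | rewrite -E0; field;
       rewrite ?e0 ?seN0 ?tN0 ?wN0].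
- by apply: (mulIf (expf_neq0 2 tN0)); apply: (mulIf (mulf_neq0 e0 seN0));
    transitivity (b * (e * sigma e) * (1 * t ^+ 2)); [ring | rewrite -E0; field;
       rewrite ?e0 ?seN0 ?tN0 ?wN0].
- by apply: (mulfI wN0); apply: (mulIf (expf_neq0 2 tN0)); apply: (mulIf (mulf_neq0 e0 seN0));
    transitivity (b * (e * sigma e) * (w * t ^+ 2)); [ring | rewrite -E0; field;
       rewrite ?e0 ?seN0 ?tN0 ?wN0].
by apply: (mulIf (expf_neq0 2 tN0)); apply: (mulIf (mulf_neq0 e0 seN0));
    transitivity (b * (e * sigma e) * (1 * t ^+ 2)); [ring | rewrite -E0; field;
       rewrite ?e0 ?seN0 ?tN0 ?wN0].
Qed.

End Conic.

Lemma exists_conic_extension (K : fieldType) (sigma : {rmorphism K -> K}) (w : K) :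
  involutive sigma -> w != 0 -> sigma w = w ->
  exists (L : fieldType) (tau : {rmorphism L -> L}) (iota : {rmorphism K -> L}) (x : L),
  [/\ x * tau x = iota w, involutive tau, forall c, tau (iota c) = iota (sigma c),
    transcendental iota x &
    forall z b, b != 0 -> z * tau z = iota b ->
      exists (c : K) (n : bool), b = c * sigma c * w ^+ n].
Proof.
move=> invol wN0 sw.
exists {fraction {poly K}}, (frac_lift (ev_inj (sigma := sigma) wN0)), (frac_const K), 'X%:F.
have XN0 : ('X : {poly K})%:F != 0 by rewrite tofrac_eq0 polyX_eq0.
split.
- by have -> := tau_X sigma wN0; rewrite mulrCA mulfV ?mulr1.
- exact: tau_invol.
- exact: tau_const.
- exact: frac_const_transcendental.
- by move=> z b; apply: conic_norm.
Qed.

Lemma eval_transcendental_inj (R : idomainType) (K L : fieldType)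
    (f : {rmorphism R -> K}) (iota : {rmorphism K -> L}) (x : L) :
  injective f -> transcendental iota x ->
  injective (eval_morph [the {rmorphism R -> L} of iota \o f] x).
Proof.
move=> f_inj tr; apply: raddf_inj => p p0.
have {}p0 : (map_poly (iota \o f) p).[x] = 0 := p0.
apply/eqP; apply: contraTT isT => pN0; move/eqP: p0; apply: contraTT => _.
rewrite map_poly_comp; apply: tr; rewrite -(rmorph0 (map_poly f)).
by rewrite inj_eq //; apply: map_inj_poly; rewrite ?rmorph0.
Qed.

(** [M] is the tower [K(x_1)(x_4)(x_2)(x_3)]: a sign change, a fixed variable [u = x_4], and two
    conics with parameters [u] and [(u - 1) * (u - x_1^2)]. The conic steps bring a norm equation
    for [u - 1] down to [K(x_1, u)], where orders of vanishing exclude it. *)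
Lemma exists_model (k K : fieldType) (j : {rmorphism k -> K}) :
  exists (M : fieldType) (rho : {rmorphism M -> M}) (iota : {rmorphism K -> M})
    (x : nat -> M),
  [/\ involutive rho /\ (forall c, rho (iota c) = iota c),
    rho (x 0) = - x 0 /\ rho (x 3) = x 3,
    x 1 * rho (x 1) = x 3 /\ x 2 * rho (x 2) = (x 3 - 1) * (x 3 - x 0 ^+ 2),
    injective (@meval k M [the {rmorphism k -> M} of iota \o j] x 4) &
    forall z, z * rho z != x 3 - 1].
Proof.
have [L1 [s1 [i1 [x1 [inv1 s1x s1i tr1]]]]] := exists_neg_extension K.
have [L2 [s2 [i2 [u [inv2 s2u s2i tr2 nonnorm]]]]] := exists_trivial_extension inv1.
have uN0 : u != 0 by have := tr2 'X; rewrite map_polyX hornerX polyX_eq0; apply.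
have uB t : u - i2 t != 0.
  have := tr2 ('X - t%:P); rewrite rmorphB /= map_polyX map_polyC !hornerE polyXsubC_eq0.
  exact.
have u1 : u - 1 != 0 by rewrite -(rmorph1 i2).
set t := x1 ^+ 2.
have s1t : s1 t = t by rewrite rmorphXn s1x sqrrN.
have t0 : t != 0.
  by rewrite expf_neq0 //; have := tr1 'X; rewrite map_polyX hornerX polyX_eq0; apply.
have t1 : t != 1.
  rewrite -subr_eq0; have := tr1 ('X^2 - 1).
  rewrite rmorphB rmorph1 /= map_polyXn !hornerE; apply.
  by rewrite -size_poly_gt0 size_XnsubC.
set w := (u - 1) * (u - i2 t).
have wN0 : w != 0 by rewrite mulf_neq0.
have s2w : s2 w = w by rewrite rmorphM !rmorphB rmorph1 s2i s2u s1t.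
have [L3 [s3 [i3 [x2 [s3x inv3 s3i tr3 norm3]]]]] := exists_conic_extension inv2 uN0 s2u.
have i3wN0 : i3 w != 0 by rewrite fmorph_eq0.
have s3w : s3 (i3 w) = i3 w by rewrite s3i s2w.
have [L4 [s4 [i4 [x3 [s4x inv4 s4i tr4 norm4]]]]] := exists_conic_extension inv3 i3wN0 s3w.
pose x i := match i with
  | 0 => i4 (i3 (i2 x1)) | 1 => i4 x2 | 2 => x3 | _ => i4 (i3 u) end%N.
pose iota := [the {rmorphism K -> L4} of i4 \o (i3 \o (i2 \o i1))].
exists L4, s4, iota, x; split.
- by split=> // c; rewrite /= s4i s3i s2i s1i.
- by split; rewrite /= s4i s3i ?s2i ?s1x ?s2u // !rmorphN.
- split; first by rewrite /= s4i -rmorphM s3x.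
  by rewrite /= s4x /w /t !(rmorphXn, rmorphM, rmorphB, rmorph1).
- pose e1 := eval_morph [the {rmorphism k -> L1} of i1 \o j] x1.
  have e1I : injective e1 by apply: eval_transcendental_inj => //; apply: fmorph_inj.
  pose e2 := eval_morph [the {rmorphism {poly k} -> L2} of i2 \o e1] u.
  have e2I : injective e2 by apply: eval_transcendental_inj.
  pose e3 := eval_morph [the {rmorphism {poly {poly k}} -> L3} of i3 \o e2] x2.
  have e3I : injective e3 by apply: eval_transcendental_inj.
  pose e4 := eval_morph [the {rmorphism {poly {poly {poly k}}} -> L4} of i4 \o e3] x3.
  have e4I : injective e4 by apply: eval_transcendental_inj.
  (* The tower adjoins the variables in the order x_1, x_4, x_2, x_3. *)
  pose swap (p : mpoly k 4) : mpoly k 4 := map_poly (@swapXY {poly k}) (swapXY p).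
  have swapI : injective swap.
    apply: inj_comp; last exact: inv_inj (@swapXYK _).
    by apply: map_inj_poly; [apply: inv_inj; apply: swapXYK | rewrite rmorph0].
  have E p : e4 (swap p) = meval [the {rmorphism k -> L4} of iota \o j] x p.
    apply: (@meval_unique k L4 [the {rmorphism k -> L4} of iota \o j] x 4
      (fun p => e4 (swap p))) => {p} [p q|p q|c|i].
    - by rewrite /swap !rmorphD.
    - by rewrite /swap !rmorphM.
    - rewrite /swap /= swapXY_polyC !map_polyC /= swapXY_polyC !map_polyC /=.
      by do 4![rewrite eval_morphE map_polyC hornerC /=].
    - case: i => [|[|[|[|i]]]] //= _; rewrite /swap /=.
      + rewrite swapXY_polyC !map_polyC /= swapXY_polyC !map_polyC /=.
        do 3![rewrite eval_morphE map_polyC hornerC /=].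
        by rewrite eval_morphE map_polyX hornerX.
      + rewrite swapXY_polyC !map_polyC /= swapXY_polyC map_polyX.
        do 1![rewrite eval_morphE map_polyC hornerC /=].
        by rewrite eval_morphE map_polyX hornerX.
      + rewrite swapXY_polyC !map_polyX.
        by rewrite eval_morphE map_polyX hornerX.
      + rewrite swapXY_X map_polyC /= swapXY_X.
        do 2![rewrite eval_morphE map_polyC hornerC /=].
        by rewrite eval_morphE map_polyX hornerX.
  by move=> p q; rewrite -!E => /e4I/swapI.
move=> z; apply/eqP => zE.
have [| |c3 [n E3]] := norm4 z (i3 (u - 1)).
- by rewrite fmorph_eq0.
- by rewrite zE /= !(rmorphB, rmorph1).
have [| |c2 [m E2]] := norm3 c3 ((u - 1) / w ^+ n).
- by rewrite mulf_neq0 // invr_eq0 expf_neq0.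
- rewrite fmorph_div E3 rmorphXn mulfK // expf_neq0 //.
move/eqP: (nonnorm t c2 m n s1t t0 t1); apply.
by rewrite -E2 -/w divfK // expf_neq0.
Qed.

Lemma exists_sqrtN1 (k : fieldType) :
  exists (K : fieldType) (j : {rmorphism k -> K}) (im : K), im ^+ 2 = -1.
Proof.
have [[im im2]|noim] := classic (exists im : k, im ^+ 2 = -1).
  by exists k, [the {rmorphism k -> k} of idfun], im.
have szP : size ('X^2 + 1 : {poly k}) = 3%N.
  by rewrite -[1]opprK -[- 1]/(- 1%:P) -polyCN size_XnsubC.
have irr : irreducible_poly ('X^2 + 1 : {poly k}).
  apply: cubic_irreducible => [|x]; [by rewrite szP | apply/negP => /rootP].
  by rewrite !hornerE => /eqP; rewrite addr_eq0 => /eqP x2; apply: noim; exists x.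
have [L _ [im /rootP]] := irredp_FAdjoin irr.
rewrite rmorphD rmorph1 /= map_polyXn !hornerE => /eqP; rewrite addr_eq0 => /eqP im2 _.
by exists L, [the {rmorphism k -> L} of GRing.in_alg L], im.
Qed.

(** * The fixed field of an endomorphism *)

Section FixedField.
Variables (M : fieldType) (rho : {rmorphism M -> M}).

Definition fixed_pred : {pred M} := [pred z | rho z == z].

Fact fixed_divring_closed : divring_closed fixed_pred.
Proof.
split=> [|x y|x y]; rewrite ?inE ?rmorph1 // => /eqP xE /eqP yE.
  by rewrite rmorphB xE yE.
by rewrite fmorph_div xE yE.
Qed.

HB.instance Definition _ := GRing.isDivringClosed.Build M fixed_pred fixed_divring_closed.

Record fixed_subfield := FixedElt { fixed_val : M; _ : fixed_val \in fixed_pred }.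
HB.instance Definition _ := [isSub for fixed_val].
HB.instance Definition _ := [Choice of fixed_subfield by <:].
HB.instance Definition _ := [SubChoice_isSubIntegralDomain of fixed_subfield by <:].
HB.instance Definition _ := [SubIntegralDomain_isSubField of fixed_subfield by <:].

(** Total on [M]: elements not fixed by [rho] are sent to the default value 0. *)
Definition fixed_elt (z : M) : fixed_subfield := insubd (0 : fixed_subfield) z.

Lemma fixed_valP (x : fixed_subfield) : rho (val x) = val x.
Proof. exact/eqP/(valP x). Qed.

Lemma fixed_eltK z : rho z = z -> val (fixed_elt z) = z.
Proof. by move=> zE; rewrite insubdK // inE zE. Qed.

Section Lift.
Variables (R : pzRingType) (f : {rmorphism R -> M}).
Hypothesis f_fixed : forall x, rho (f x) = f x.

Fact fixed_lift_exists : exists h : {rmorphism R -> fixed_subfield},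
  forall x, val (h x) = f x.
Proof.
pose h x := fixed_elt (f x).
have hE x : val (h x) = f x by exact: fixed_eltK.
have hz : zmod_morphism h.
  by move=> x y; apply: val_inj; rewrite hE rmorphB -!hE -(rmorphB val).
have hm : monoid_morphism h.
  split=> [|x y]; apply: val_inj; first by rewrite hE rmorph1 (rmorph1 val).
  by rewrite hE rmorphM -!hE -(rmorphM val).
pose H : {rmorphism R -> fixed_subfield} := HB.pack h
  (GRing.isZmodMorphism.Build _ _ _ hz) (GRing.isMonoidMorphism.Build _ _ _ hm).
by exists H.
Qed.
End Lift.
End FixedField.

(** * Transport of identities through a retract *)

Section Retract.
Variables (k K : fieldType) (iota : {rmorphism k -> K}) (F A : pred K) (m : nat).
Variables (f : mpoly k m) (phi : K -> {fraction (mpoly k m)}).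
Variable psi : {fraction (mpoly k m)} -> K.
Hypothesis A_iota : forall c, iota c \in A.
Hypothesis A_ring : forall a b, a \in A -> b \in A -> [/\ a + b \in A, - a \in A & a * b \in A].
Hypothesis A_frac : forall x, x \in F -> exists a b, [/\ a \in A, b \in A, b != 0 & x = a / b].
Hypothesis f_neq0 : f != 0.
Hypothesis phi_loc : forall a, a \in A -> in_loc f (phi a).
Hypothesis phiD : forall a b, a \in A -> b \in A -> phi (a + b) = phi a + phi b.
Hypothesis phiM : forall a b, a \in A -> b \in A -> phi (a * b) = phi a * phi b.
Hypothesis psiM : forall u v, in_loc f u -> in_loc f v -> psi (u * v) = psi u * psi v.
Hypothesis psi_cst : forall c, psi (mcst m c)%:F = iota c.
Hypothesis phiK : forall a, a \in A -> psi (phi a) = a.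

Lemma in_loc_tofrac p : in_loc f p%:F.
Proof. by exists p, 0; rewrite divr1. Qed.

Let fF : f%:F != 0. Proof. by rewrite tofrac_eq0. Qed.

Lemma psi1 : psi 1 = 1.
Proof.
have -> : 1 = (mcst m (1 : k))%:F.
  by rewrite -tofrac1; congr (_%:F); elim: (m) => //= n <-.
by rewrite psi_cst rmorph1.
Qed.

Lemma psi_f_neq0 : psi f%:F != 0.
Proof.
have : psi f%:F * psi (f%:F)^-1 = 1.
  rewrite -psiM ?mulfV ?psi1 //; first exact: in_loc_tofrac.
  by exists 1, 1; rewrite expr1 tofrac1 mul1r.
by apply: contra_eq_neq => ->; rewrite mul0r eq_sym oner_neq0.
Qed.

Lemma psi_fX n : psi (f%:F ^+ n) = psi f%:F ^+ n.
Proof.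
elim: n => [|n IH]; first by rewrite psi1.
by rewrite !exprS psiM ?IH -?tofracXn //; apply: in_loc_tofrac.
Qed.

Lemma psi_num a p n : a \in A -> phi a * f%:F ^+ n = p%:F ->
  psi p%:F = a * psi f%:F ^+ n.
Proof.
move=> aA <-; rewrite psiM ?psi_fX ?phiK //; first exact: phi_loc.
by rewrite -tofracXn; apply: in_loc_tofrac.
Qed.

Lemma common_den (s : seq K) : {in s, forall x, x \in F} ->
  exists d, [/\ d \in A, d != 0 & {in s, forall x, x * d \in A}].
Proof.
elim: s => [|x s IH] sF.
  by exists (iota 1); rewrite rmorph1 oner_neq0; split=> //; rewrite -(rmorph1 iota).
have [|d [dA d0 sd]] := IH; first by move=> z zs; apply: sF; rewrite inE zs orbT.
have [a [b [aA bA b0 xE]]] := A_frac (sF x (mem_head _ _)).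
exists (b * d); split; [by case: (A_ring bA dA)|by rewrite mulf_neq0|].
move=> z; rewrite inE => /predU1P[->|/sd zA].
  by rewrite xE mulrA divfK //; case: (A_ring aA dA).
by rewrite mulrCA; case: (A_ring bA zA).
Qed.

Lemma common_exponent (s : seq K) : {in s, forall x, x \in A} ->
  exists n, {in s, forall x, exists p, phi x * f%:F ^+ n = p%:F}.
Proof.
elim: s => [|x s IH] sA; first by exists 0.
have [|n sn] := IH; first by move=> z zs; apply: sA; rewrite inE zs orbT.
have [p [l pE]] := phi_loc (sA x (mem_head _ _)).
exists (n + l)%N => z; rewrite inE => /predU1P[->|/sn [q qE]].
  exists (p * f ^+ n); rewrite pE tofracM tofracXn addnC exprD mulrA divfK //.
  by rewrite expf_neq0.
by exists (q * f ^+ l); rewrite tofracM tofracXn -qE exprD mulrA.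
Qed.

Lemma phiB a b : a \in A -> b \in A -> phi (a - b) = phi a - phi b.
Proof.
move=> aA bA; have [_ nbA _] := A_ring bA bA.
have [abA _ _] := A_ring aA nbA.
by apply: (addIr (phi b)); rewrite -phiD // !subrK.
Qed.

Lemma A_mul a b : a \in A -> b \in A -> a * b \in A.
Proof. by move=> aA bA; case: (A_ring aA bA). Qed.

Lemma A_sub a b : a \in A -> b \in A -> a - b \in A.
Proof.
move=> aA bA; have [_ nbA _] := A_ring bA bA.
by case: (A_ring aA nbA).
Qed.

(** The relation [u = x^2 - y b^2] with its variables scaled by a common denominator [d]: all terms
    lie in [A], where [phi] respects sums and products. *)
Lemma phi_rel1 a d y b x :
  a \in A -> d \in A -> y \in A -> b \in A -> x \in A ->
  a * d ^+ 2 + y * b ^+ 2 = x ^+ 2 * d ->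
  phi a * phi d ^+ 2 + phi y * phi b ^+ 2 = phi x ^+ 2 * phi d.
Proof.
move=> aA dA yA bA xA; rewrite !expr2 => E.
by rewrite -!phiM ?A_mul // -phiD ?A_mul // E.
Qed.

Lemma phi_rel2 a d y t z :
  a \in A -> d \in A -> y \in A -> t \in A -> z \in A ->
  (a - d) * (a - y) * d + y * t ^+ 2 = z ^+ 2 * d ->
  (phi a - phi d) * (phi a - phi y) * phi d + phi y * phi t ^+ 2 = phi z ^+ 2 * phi d.
Proof.
move=> aA dA yA tA zA; rewrite !expr2 => E.
by rewrite -!phiB // -!phiM ?A_mul ?A_sub // -phiD ?A_mul ?A_sub // E.
Qed.

Lemma hom_rel1 (L : fieldType) (c a d y b x : L) :
  a * d ^+ 2 + y * b ^+ 2 = x ^+ 2 * d ->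
  (a * c) * (d * c) * (d * c) ^+ 2 =
  ((x * c) * (d * c)) ^+ 2 - (y * c) * (d * c) * (b * c) ^+ 2.
Proof.
move=> E; transitivity (d * c ^+ 4 * (a * d ^+ 2 + y * b ^+ 2 - y * b ^+ 2)); first by ring.
by rewrite E; ring.
Qed.

Lemma hom_rel2 (L : fieldType) (c a d y t z : L) :
  (a - d) * (a - y) * d + y * t ^+ 2 = z ^+ 2 * d ->
  (a * c - d * c) * (a * c - y * c) * (d * c) ^+ 2 =
  ((z * c) * (d * c)) ^+ 2 - (y * c) * (d * c) * (t * c) ^+ 2.
Proof.
move=> E; transitivity (d * c ^+ 4 * ((a - d) * (a - y) * d + y * t ^+ 2 - y * t ^+ 2)).
  by ring.
by rewrite E; ring.
Qed.

(** The elements are multiplied by a common denominator [d] in [A], sent through [phi] and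
    multiplied by a power of [f]. The resulting polynomials obey the same relations in homogeneous
    form, with [D] coming from [d], and [psi] recovers [y] and [u] as ratios. *)
Lemma retract_transfer y u x b z t :
  {in [:: y; u; x; b; z; t], forall v, v \in F} ->
  u = x ^+ 2 - y * b ^+ 2 -> (u - 1) * (u - y) = z ^+ 2 - y * t ^+ 2 ->
  exists Y U D X B Z T : mpoly k m,
  [/\ psi D%:F != 0, psi Y%:F = y * psi D%:F, psi U%:F = u * psi D%:F,
     U * D * D ^+ 2 = X ^+ 2 - Y * D * B ^+ 2 &
     (U - D) * (U - Y) * D ^+ 2 = Z ^+ 2 - Y * D * T ^+ 2].
Proof.
move=> /common_den[d [dA d0 sd]] E1 E2.
have in_s v : v \in [:: y; u; x; b; z; t] -> v * d \in A by exact: sd.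
have [yA uA xA] : [/\ y * d \in A, u * d \in A & x * d \in A].
  by split; apply: in_s; rewrite !inE eqxx ?orbT.
have [bA zA tA] : [/\ b * d \in A, z * d \in A & t * d \in A].
  by split; apply: in_s; rewrite !inE eqxx ?orbT.
pose s := [:: d; y * d; u * d; x * d; b * d; z * d; t * d].
have [|n sn] := @common_exponent s.
  by move=> v; rewrite !inE; do 6![case/predU1P => [->//|]]; move/eqP->.
have num v : v \in s -> exists p, phi v * f%:F ^+ n = p%:F by exact: sn.
have [D DE] : exists p, phi d * f%:F ^+ n = p%:F by apply: num; rewrite !inE eqxx.
have [Y YE] := num (y * d) ltac:(by rewrite !inE eqxx ?orbT).
have [U UE] := num (u * d) ltac:(by rewrite !inE eqxx ?orbT).
have [X XE] := num (x * d) ltac:(by rewrite !inE eqxx ?orbT).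
have [B BE] := num (b * d) ltac:(by rewrite !inE eqxx ?orbT).
have [Z ZE] := num (z * d) ltac:(by rewrite !inE eqxx ?orbT).
have [T TE] := num (t * d) ltac:(by rewrite !inE eqxx ?orbT).
have rel1 : phi (u * d) * phi d ^+ 2 + phi (y * d) * phi (b * d) ^+ 2 =
    phi (x * d) ^+ 2 * phi d.
  by apply: phi_rel1 => //; rewrite E1; ring.
have rel2 : (phi (u * d) - phi d) * (phi (u * d) - phi (y * d)) * phi d
    + phi (y * d) * phi (t * d) ^+ 2 = phi (z * d) ^+ 2 * phi d.
  apply: phi_rel2 => //.
  transitivity (d ^+ 3 * ((u - 1) * (u - y) + y * t ^+ 2)); first by ring.
  by rewrite E2; ring.
have psiDE := psi_num dA DE.
(* The extra factor [D] in the witnesses for [X] and [Z] makes both relations homogeneous of degree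
   4. *)
exists Y, U, D, (X * D), B, (Z * D), T; split.
- by rewrite psiDE mulf_neq0 ?expf_neq0 // psi_f_neq0.
- by rewrite (psi_num yA YE) psiDE mulrA.
- by rewrite (psi_num uA UE) psiDE mulrA.
- apply/eqP; rewrite -tofrac_eq !(tofracB, tofracXn, tofracM) -YE -UE -DE -XE -BE.
  by apply/eqP; apply: hom_rel1.
apply/eqP; rewrite -tofrac_eq !(tofracB, tofracXn, tofracM) -YE -UE -DE -ZE -TE.
by apply/eqP; apply: hom_rel2.
Qed.

End Retract.

(** The symbol of [y/d] and [u/d - 1] is unramified at every prime of [E[s]], and its first slot is
    a nonzero square at [s = 1]; so the ternary form has a zero over [E[s]], which is then
    specialized to [s = 0]. *)
Lemma unramified_specialization (E : fieldType) (im : E) (y u d x b z t : {poly E}) r :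
  im ^+ 2 = -1 ->
  u * d * d ^+ 2 = x ^+ 2 - y * d * b ^+ 2 ->
  (u - d) * (u - y) * d ^+ 2 = z ^+ 2 - y * d * t ^+ 2 ->
  y.[0] != 0 -> u.[0] != 0 -> d.[0] != 0 -> (u - d).[0] != 0 -> (u - y).[0] != 0 ->
  (y * d).[1] = r ^+ 2 -> r != 0 -> ((u - d) * d).[1] != 0 ->
  exists p q s : E, [|| p != 0, q != 0 | s != 0] /\
    p ^+ 2 = (y * d).[0] * q ^+ 2 + ((u - d) * d).[0] * s ^+ 2.
Proof.
move=> im2 E1 E2 y0 u0 d0 ud0 uy0 yd1 rN0 udd1.
have nz (p : {poly E}) : p.[0] != 0 -> p != 0 by apply: contraNneq => ->; rewrite horner0.
have [yN0 uN0 dN0 udN0 uyN0] := And5 (nz _ y0) (nz _ u0) (nz _ d0) (nz _ ud0) (nz _ uy0).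
have un pi (pi_irr : irreducible_poly pi) : unram pi_irr (y * d) ((u - d) * d).
  apply: (unram_main im2 yN0 uN0 dN0 udN0 uyN0); 
    [apply: (unram_norm im2 pi_irr) E1 | apply: (unram_norm im2 pi_irr) E2];
    by rewrite ?mulf_neq0.
have [w wN0 w0] := unram_isotropic im2 un yd1 rN0 udd1.
exact: (isotropic_specialize 0 wN0 w0).
Qed.

(** * Comparison of the rational function field with a model of the action *)

Lemma X4_neq0 (k : fieldType) i : (i < 4)%N -> X4 k i != 0.
Proof.
by case: i => [|[|[|[|i]]]] //= _; rewrite /X4 tofrac_eq0 /= ?polyC_eq0 polyX_eq0.
Qed.

Lemma X4_3_sub_neq0 (k : fieldType) p : X4 k 3 - p%:P%:F != 0.
Proof. by rewrite /X4 -tofracB tofrac_eq0 /= polyXsubC_eq0. Qed.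

Definition cst4_morph (k : fieldType) : {rmorphism k -> ratfun4 k} :=
  [the {rmorphism k -> ratfun4 k} of
    @FracField.tofrac (mpoly k 4) \o (@polyC (mpoly k 3) \o (@polyC (mpoly k 2) \o
      (@polyC (mpoly k 1) \o @polyC k)))].

Lemma morph_rho2 (L M : fieldType) (f : {rmorphism L -> M}) a b c :
  f ((a - 1) * (a - b ^+ 2) / c) = (f a - 1) * (f a - f b ^+ 2) / f c.
Proof. by rewrite fmorph_div rmorphM !rmorphB rmorph1 rmorphXn. Qed.

Section Model.
Variables (k M : fieldType) (rhoM : {rmorphism M -> M}) (j : {rmorphism k -> M}).
Variable x : nat -> M.
Hypothesis j_fixed : forall c, rhoM (j c) = j c.
Hypotheses (rho0 : rhoM (x 0) = - x 0) (rho3 : rhoM (x 3) = x 3).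
Hypothesis rho1 : x 1 * rhoM (x 1) = x 3.
Hypothesis rho2 : x 2 * rhoM (x 2) = (x 3 - 1) * (x 3 - x 0 ^+ 2).
Hypothesis x_indep : injective (@meval k M j x 4).

Let J : {rmorphism ratfun4 k -> M} := frac_lift x_indep.

Lemma model_tofrac p : J p%:F = meval j x p.
Proof. exact: frac_lift_tofrac. Qed.

Lemma model_X i : (i < 4)%N -> J (X4 k i) = x i.
Proof. by move=> lti; rewrite /X4 model_tofrac; apply: meval_var. Qed.

Lemma model_cst c : J (cst4 c) = j c.
Proof. by rewrite /cst4 model_tofrac; apply: meval_cst. Qed.

Lemma model_rho_img i : (i < 4)%N -> J (rho_img k i) = rhoM (x i).
Proof.
have x0 i' : (i' < 4)%N -> x i' != 0 by move=> lti; rewrite -model_X // fmorph_eq0 X4_neq0.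
case: i => [|[|[|[|i]]]] //= _.
- by rewrite rmorphN model_X.
- have -> : J (X4 k 3 / X4 k 1) = J (X4 k 3) / J (X4 k 1) by exact: fmorph_div.
  transitivity (x 3 / x 1); first by congr (_ / _); apply: model_X.
  by rewrite -rho1 mulrC mulKf ?x0.
- rewrite (morph_rho2 J).
  transitivity ((x 3 - 1) * (x 3 - x 0 ^+ 2) / x 2).
    by congr ((_ - 1) * (_ - _ ^+ 2) / _); apply: model_X.
  by rewrite -rho2 mulrC mulKf ?x0.
- by rewrite model_X.
Qed.

Lemma model_rho_pol p : J (@rho_pol k p) = rhoM (meval j x p).
Proof.
pose a i := rhoM (x i).
transitivity (meval j a p).
  apply: (@meval_unique k M j a 4 (fun p => J (@rho_pol k p))) => [q r|q r|c|i lti].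
  - by rewrite -rmorphD; congr (J _); apply: (rmorphD (@meval k _ (cst4_morph k) (@rho_img k) 4)).
  - by rewrite -rmorphM; congr (J _); apply: (rmorphM (@meval k _ (cst4_morph k) (@rho_img k) 4)).
  - by rewrite -model_cst; congr (J _); apply: (@meval_cst _ _ (cst4_morph k) _ 4).
  - rewrite /a -model_rho_img //; congr (J _).
    exact: (@meval_var _ _ (cst4_morph k) (@rho_img k) 4).
symmetry; apply: (@meval_unique k M j a 4 (fun p => rhoM (meval j x p))) => [q r|q r|c|i lti].
- by rewrite !rmorphD.
- by rewrite !rmorphM.
- by rewrite (meval_cst j x) j_fixed.
- by rewrite (meval_var j x lti).
Qed.

(** [rho] is computed from chosen numerators and denominators; [J] identifies it with the ring
    morphism [rhoM], so that its fixed elements become those of [rhoM]. *)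
Lemma model_rho z : J (rho z) = rhoM (J z).
Proof.
transitivity (J (rho_pol \n_(repr z)) / J (rho_pol \d_(repr z))).
  exact: fmorph_div.
transitivity (rhoM (meval j x \n_(repr z)) / rhoM (meval j x \d_(repr z))).
  by congr (_ / _); apply: model_rho_pol.
by symmetry; apply: (fmorph_div rhoM).
Qed.

Lemma model_fixed z : (z \in @fixed_field k) = (rhoM (J z) == J z).
Proof. by rewrite unfold_in /fixed_field -model_rho (inj_eq (fmorph_inj J)). Qed.

End Model.

(** * Norms, anisotropy and the contradiction *)

Lemma norm_split (L : fieldType) (a w x : L) : (2%:R : L) != 0 -> a != 0 -> x != 0 ->
  w = ((a + w / a) / 2%:R) ^+ 2 - x ^+ 2 * ((a - w / a) / (2%:R * x)) ^+ 2.
Proof. by move=> n2 a0 x0; field; rewrite a0 x0 n2. Qed.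

(** As [a] has norm [w], [w / a] is its conjugate; the two components are the even part of [a], and
    its odd part divided by the odd element [x]. *)
Lemma norm_split_fixed (L M : fieldType) (J : {rmorphism L -> M}) (rho : {rmorphism M -> M})
    (a w x : L) :
  involutive rho -> a != 0 -> J a * rho (J a) = J w -> rho (J x) = - J x ->
  rho (J ((a + w / a) / 2%:R)) = J ((a + w / a) / 2%:R) /\
  rho (J ((a - w / a) / (2%:R * x))) = J ((a - w / a) / (2%:R * x)).
Proof.
move=> invol a0 nw rx; have Ja : J a != 0 by rewrite fmorph_eq0.
have wa : J (w / a) = rho (J a) by rewrite fmorph_div -nw mulrC mulKf.
have -> : J ((a + w / a) / 2%:R) = (J a + rho (J a)) / 2%:R.
  by rewrite fmorph_div rmorphD wa rmorph_nat.
have -> : J ((a - w / a) / (2%:R * x)) = (J a - rho (J a)) / (2%:R * J x).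
  by rewrite fmorph_div rmorphB rmorphM wa rmorph_nat.
rewrite !fmorph_div rmorphD rmorphB rmorphM rmorph_nat invol rx; split.
  by rewrite addrC.
by rewrite mulrN invrN mulrN -mulNr opprB.
Qed.

(** For [s] nonzero, [(p + x d q) / (d s)] would have norm [u - 1]. For [s = 0], [p] equals [x d q]
    up to sign, so it is both fixed and negated by [rho], hence 0. *)
Lemma quaternion_anisotropic (M : fieldType) (rho : {rmorphism M -> M}) (x u d p q s : M) :
  (2%:R : M) != 0 -> x != 0 -> d != 0 -> rho x = - x -> rho d = d ->
  (forall z, z * rho z != u - 1) -> rho p = p -> rho q = q -> rho s = s ->
  [|| p != 0, q != 0 | s != 0] ->
  p ^+ 2 != x ^+ 2 * d * d * q ^+ 2 + (u * d - d) * d * s ^+ 2.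
Proof.
move=> n2 x0 d0 rx rd nonnorm rp rq rs nz; apply/eqP => E.
have [s0|sN0] := eqVneq s 0; last first.
  move/eqP: (nonnorm ((p + x * d * q) / (d * s))); apply.
  rewrite fmorph_div rmorphD !rmorphM rx rd rp rq rs.
  transitivity ((p ^+ 2 - x ^+ 2 * d * d * q ^+ 2) / (d * s) ^+ 2).
    by field; rewrite d0 sN0.
  by rewrite E; field; rewrite d0 sN0.
have : (p - x * d * q) * (p + x * d * q) = 0.
  transitivity (p ^+ 2 - x ^+ 2 * d * d * q ^+ 2); first by ring.
  by rewrite E s0; ring.
have key t : rho t = t -> rho t = - t -> t = 0.
  move=> -> /eqP; rewrite -addr_eq0 -mulr2n -mulr_natl mulf_eq0 (negPf n2) /= => /eqP.
  by [].
have pq : p = x * d * q \/ p = - (x * d * q) -> p = 0.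
  move=> pE; apply: key => //; case: pE => ->; rewrite ?rmorphN !rmorphM rx rd rq; ring.
move/eqP; rewrite mulf_eq0 subr_eq0 addr_eq0 => h.
have p0 : p = 0 by apply: pq; case/orP: h => /eqP; [left|right].
have xdq : x * d * q = 0.
  by case/orP: h => /eqP; rewrite p0 => // /esym/eqP; rewrite oppr_eq0 => /eqP.
move: nz; rewrite p0 s0 eqxx /= orbF => /negP; apply.
by move/eqP: xdq; rewrite !mulf_eq0 (negPf x0) (negPf d0).
Qed.

(** [J1] carries exactly [F] into the fixed field [E], and [J2] all of [L], so that [X0 ^+ 2]
    becomes a square in [E] under [J2]. Along the line joining the two points, isotropy at [J2]
    passes to [J1], where the non-norm hypothesis excludes it. *)
Lemma not_retract_of_model (k L M : fieldType) (cst : {rmorphism k -> L}) (F : pred L)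
    (X0 X1 X2 X3 : L) (rho : {rmorphism M -> M}) (J1 J2 : {rmorphism L -> M})
    (im x0 x1 x2 x3 : M) :
  (2%:R : k) != 0 -> im ^+ 2 = -1 -> rho im = im -> involutive rho ->
  (forall z, (z \in F) = (rho (J1 z) == J1 z)) -> (forall z, rho (J2 z) = J2 z) ->
  (forall c, J1 (cst c) = J2 (cst c)) ->
  X0 != 0 -> X1 != 0 -> X2 != 0 -> X3 != 0 -> X3 - 1 != 0 -> X3 - X0 ^+ 2 != 0 ->
  J1 X0 = x0 -> J1 X1 = x1 -> J1 X2 = x2 -> J1 X3 = x3 ->
  rho x0 = - x0 -> rho x3 = x3 -> x1 * rho x1 = x3 ->
  x2 * rho x2 = (x3 - 1) * (x3 - x0 ^+ 2) ->
  (forall z, z * rho z != x3 - 1) ->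
  ~ retract_rational cst F.
Proof.
move=> hk im2 rim invol FE J2F Jcst X00 X10 X20 X30 X31 X3y <- <- <- <- r0 r3 n1 n2' nonnorm.
have n2 : J1 X2 * rho (J1 X2) = J1 ((X3 - 1) * (X3 - X0 ^+ 2)).
  by rewrite n2' rmorphM !rmorphB rmorph1 rmorphXn.
case=> A [m [f [phi [psi [[A_c A_ring A_F A_frac] fN0 [phi_loc phiD phiM phi_c]
  [psi_A psiD psiM psi_c] phiK]]]]].
have hL : (2%:R : L) != 0 by rewrite -(rmorph_nat cst) fmorph_eq0.
have hM : (2%:R : M) != 0 by rewrite -(rmorph_nat J1) fmorph_eq0.
have E1 := norm_split X3 hL X10 X00.
have E2 := norm_split ((X3 - 1) * (X3 - X0 ^+ 2)) hL X20 X00.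
have [f1 f2] := norm_split_fixed invol X10 n1 r0.
have [f3 f4] := norm_split_fixed invol X20 n2 r0.
move: ((X1 + _) / _) ((X1 - _) / _) E1 f1 f2 => x b E1 f1 f2.
move: ((X2 + _) / _) ((X2 - _) / _) E2 f3 f4 => z t E2 f3 f4.
have inF : {in [:: X0 ^+ 2; X3; x; b; z; t], forall v, v \in F}.
  move=> v; rewrite !inE FE.
  case/predU1P => [->|]; first by apply/eqP; rewrite !rmorphXn r0 sqrrN.
  do 4![case/predU1P => [->|]; first exact/eqP].
  by move/eqP->; apply/eqP.
have [Y [U [D [X [B [Z [T [psiD0 psiY psiU rel1 rel2]]]]]]]] :=
  retract_transfer A_c A_ring A_frac fN0 phi_loc phiD phiM psiM psi_c phiK inF E1 E2.
pose E := fixed_subfield rho.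
have psi_fix p : rho (J1 (psi p%:F)) = J1 (psi p%:F).
  by apply/eqP; rewrite -FE; apply: A_F; apply: psi_A; apply: in_loc_tofrac.
have cst_fix c : rho ((J1 \o cst) c) = (J1 \o cst) c by rewrite /= Jcst J2F.
have [kap kapE] := fixed_lift_exists cst_fix.
(* Coordinates of the two points: the variables are sent through [psi] and then through [J1] for
   [s = 0], or [J2] for [s = 1]. *)
pose a i : E := fixed_elt rho (J1 (psi (mvar k m i)%:F)).
pose b' i : E := fixed_elt rho (J2 (psi (mvar k m i)%:F)).
have aE i : val (a i) = J1 (psi (mvar k m i)%:F) by exact: fixed_eltK.
have bE i : val (b' i) = J2 (psi (mvar k m i)%:F) by exact: fixed_eltK.
pose kapP := [the {rmorphism k -> {poly E}} of @polyC E \o kap].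
(* Restriction of a polynomial to the line through the two points. *)
pose h := @meval k {poly E} kapP (fun i => (a i)%:P + 'X * (b' i - a i)%:P) m.
have hD p q : h (p + q) = h p + h q by exact: rmorphD.
have hB p q : h (p - q) = h p - h q by exact: rmorphB.
have hM' p q : h (p * q) = h p * h q by exact: rmorphM.
have hX p n : h (p ^+ n) = h p ^+ n by exact: rmorphXn.
have psiDp p q : psi (p + q)%:F = psi p%:F + psi q%:F.
  by rewrite tofracD psiD //; apply: in_loc_tofrac.
have psiMp p q : psi (p * q)%:F = psi p%:F * psi q%:F.
  by rewrite tofracM psiM //; apply: in_loc_tofrac.
have h0 p : val (h p).[0] = J1 (psi p%:F).
  transitivity (meval [the {rmorphism k -> M} of val \o kap] (fun i => val (a i)) p).
    apply: (@meval_unique k M [the {rmorphism k -> M} of val \o kap] (fun i => val (a i)) m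
      (fun p => val (h p).[0])) => [q r|q r|c|i lti]; cbv beta.
    - by rewrite hD hornerD rmorphD.
    - by rewrite hM' hornerM rmorphM.
    - by rewrite /h meval_cst hornerC.
    - by rewrite /h meval_var // !hornerE.
  symmetry; apply: (@meval_unique k M [the {rmorphism k -> M} of val \o kap] (fun i => val (a i)) m
    (fun p => J1 (psi p%:F))) => [q r|q r|c|i lti]; cbv beta.
  - by rewrite psiDp rmorphD.
  - by rewrite psiMp rmorphM.
  - by rewrite psi_c /= kapE.
  - by rewrite aE.
have h1 p : val (h p).[1] = J2 (psi p%:F).
  transitivity (meval [the {rmorphism k -> M} of val \o kap] (fun i => val (b' i)) p).
    apply: (@meval_unique k M [the {rmorphism k -> M} of val \o kap] (fun i => val (b' i)) m
      (fun p => val (h p).[1])) => [q r|q r|c|i lti]; cbv beta.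
    - by rewrite hD hornerD rmorphD.
    - by rewrite hM' hornerM rmorphM.
    - by rewrite /h meval_cst hornerC.
    - by rewrite /h meval_var // hornerD hornerC hornerM hornerX hornerC mul1r addrC subrK.
  symmetry; apply: (@meval_unique k M [the {rmorphism k -> M} of val \o kap] (fun i => val (b' i)) m
    (fun p => J2 (psi p%:F))) => [q r|q r|c|i lti]; cbv beta.
  - by rewrite psiDp rmorphD.
  - by rewrite psiMp rmorphM.
  - by rewrite psi_c /= kapE /= Jcst.
  - by rewrite bE.
have val0 (v : E) : (val v == 0) = (v == 0) by rewrite fmorph_eq0.
have valB (v w : E) : val (v - w) = val v - val w by exact: rmorphB.
have valD (v w : E) : val (v + w) = val v + val w by exact: rmorphD.
have valN (v : E) : val (- v) = - val v by exact: rmorphN.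
have valM (v w : E) : val (v * w) = val v * val w by exact: rmorphM.
have valX (v : E) n : val (v ^+ n) = val v ^+ n by exact: rmorphXn.
have im2E : (fixed_elt rho im) ^+ 2 = -1.
  by apply: val_inj; rewrite valX (rmorphN1 val) /= fixed_eltK.
(* The square root of [y * d] at [s = 1]; it lies in [E] because [J2] takes fixed values. *)
pose r := fixed_elt rho (J2 (X0 * psi D%:F)).
have rE : val r = J2 (X0 * psi D%:F) by exact: fixed_eltK.
set d := psi D%:F in psiD0 psiY psiU rE.
have D0 : val (h D).[0] = J1 d by exact: h0.
have D1 : val (h D).[1] = J2 d by exact: h1.
have Y0 : val (h Y).[0] = J1 X0 ^+ 2 * J1 d by rewrite h0 psiY rmorphM rmorphXn.
have Y1 : val (h Y).[1] = J2 X0 ^+ 2 * J2 d by rewrite h1 psiY rmorphM rmorphXn.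
have U0 : val (h U).[0] = J1 X3 * J1 d by rewrite h0 psiU rmorphM.
have U1 : val (h U).[1] = J2 X3 * J2 d by rewrite h1 psiU rmorphM.
have [|||||||||| p [q [s [nz iso]]]] :=
  @unramified_specialization E (fixed_elt rho im) (h Y) (h U) (h D) (h X) (h B) (h Z) (h T) r im2E.
- by move: (congr1 h rel1); rewrite !(hX, hM', hB).
- by move: (congr1 h rel2); rewrite !(hX, hM', hB).
- by rewrite -val0 Y0 mulf_neq0 ?expf_neq0 // fmorph_eq0.
- by rewrite -val0 U0 mulf_neq0 // fmorph_eq0.
- by rewrite -val0 D0 fmorph_eq0.
- by rewrite -val0 hornerD hornerN valB U0 D0 -rmorphM -rmorphB
    fmorph_eq0 -[X in _ - X]mul1r -mulrBl mulf_neq0.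
- by rewrite -val0 hornerD hornerN valB U0 Y0 -rmorphXn -!rmorphM
    -rmorphB fmorph_eq0 -mulrBl mulf_neq0.
- apply: val_inj; rewrite hornerM valM valX Y1 D1 rE rmorphM; ring.
- by rewrite -val0 rE fmorph_eq0 mulf_neq0.
- rewrite -val0 hornerM hornerD hornerN valM valB U1 D1.
  by rewrite -rmorphM -rmorphB -rmorphM fmorph_eq0 mulf_neq0 //
    -[X in _ - X]mul1r -mulrBl mulf_neq0.
have rd : rho (J1 d) = J1 d by rewrite -D0 fixed_valP.
have /eqP : val p ^+ 2 != J1 X0 ^+ 2 * J1 d * J1 d * val q ^+ 2
    + (J1 X3 * J1 d - J1 d) * J1 d * val s ^+ 2.
  apply: (quaternion_anisotropic hM _ _ r0 rd nonnorm); rewrite ?fixed_valP ?val0 //.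
    by rewrite fmorph_eq0.
  by rewrite fmorph_eq0.
apply; move/(congr1 val): iso; rewrite !hornerM hornerD hornerN.
by rewrite !(valX, valD, valM, valN) Y0 U0 D0.
Qed.

Theorem theorem6p3 (k : fieldType) (hk : (2%:R : k) != 0) :
  ~ retract_rational (@cst4 k) (@fixed_field k).
Proof.
(* [K] contains a square root of -1 and a copy of the function field, both fixed by [rho] in the
   model over [K]. Below, [J1] sends the variables to the new [x i] of the model, and [J2] sends
   them to their copies in [K]. *)
have [K [j [im im2]]] := exists_sqrtN1 (ratfun4 k).
pose jk := [the {rmorphism k -> K} of j \o cst4_morph k].
have [M [rho [iota [x [[invol rho_iota] [r0 r3] [n1 n2] indep nonnorm]]]]] := exists_model jk.
pose jM := [the {rmorphism k -> M} of iota \o jk].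
have jM_fixed c : rho (jM c) = jM c by exact: rho_iota.
pose J1 : {rmorphism ratfun4 k -> M} := frac_lift indep.
pose J2 := [the {rmorphism ratfun4 k -> M} of iota \o j].
have JX i : (i < 4)%N -> J1 (X4 k i) = x i by exact: model_X.
have FE := model_fixed jM_fixed r0 r3 n1 n2 indep.
have Jc c : J1 (cst4_morph k c) = J2 (cst4_morph k c) by exact: (model_cst indep).
have im2M : (iota im) ^+ 2 = -1 by rewrite -rmorphXn im2 rmorphN1.
have X31 : X4 k 3 - 1 != 0 by have := X4_3_sub_neq0 (1 : mpoly k 3).
have X3y : X4 k 3 - X4 k 0 ^+ 2 != 0.
  by have := X4_3_sub_neq0 (mvar k 3 0 ^+ 2); rewrite polyC_exp tofracXn.
exact: (not_retract_of_model (cst := cst4_morph k) (J1 := J1) (J2 := J2)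
  hk im2M (rho_iota im) invol FE
  (fun z => rho_iota (j z)) Jc (X4_neq0 k (i := 0) isT) (X4_neq0 k (i := 1) isT)
  (X4_neq0 k (i := 2) isT) (X4_neq0 k (i := 3) isT) X31 X3y
  (JX 0 isT) (JX 1 isT) (JX 2 isT) (JX 3 isT) r0 r3 n1 n2 nonnorm).
Qed.
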